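(* Let $(\xi,a,\omega)$ be shear data on a smooth manifold $M$, let $(P,\theta,\rho)$ be a shear total space for $\omega$ with projection $\pi\colon P\to M$, and suppose that the shear $S=P/\mathring\xi(\pi^*E)$ is smooth, with projection $\pi_S\colon P\to S$. For almost complex structures $I$ on $M$ and $I_S$ on $S$ with $I\sim_{\mathcal{H}}I_S$, the Nijenhuis tensors are related by $$N_I-\mathcal{F}-I\mathcal{F}(I\cdot,\cdot)-I\mathcal{F}(\cdot,I\cdot)+\mathcal{F}(I\cdot,I\cdot)\ \sim_{\mathcal{H}}\ N_{I_S},$$ where $\mathcal{F}=\xi a^{-1}\omega\in\Omega^2(M,TM)$.
   Context: All flat connections and the induced connections on tensor products, duals and pull-backs are denoted $\nabla$; $d^\nabla$ is the covariant exterior derivative. For a bundle map $\xi\colon E\to TM$ and a $V$-valued $k$-form $\beta$, $(\xi\lrcorner\,\beta)(X_2,\dots,X_k)(e)=\beta(\xi e,X_2,\dots,X_k)$. Shear data on $M$: a triple $(\xi,a,\omega)$ where $E,F\to M$ are flat vector bundles of the same rank, $\xi\colon E\to TM$ is a bundle map, $a\colon E\to F$ is an invertible bundle morphism and $\omega\in\Omega^2(M,F)$, such that (i) $\xi(\nabla_{\xi e_1}e_2-\nabla_{\xi e_2}e_1)=[\xi e_1,\xi e_2]$ for all $e_1,e_2\in\Gamma(E)$; (ii) $d^\nabla\omega=0$; (iii) $\xi\lrcorner\,\omega=-d^\nabla a$; (iv) $\xi^*\omega=0$. Shear total space $(P,\theta,\rho)$ for $\omega$: $P$ is a manifold with a foliation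 with (connected) leaves of dimension $\operatorname{rk}F$ and leaf space $M$, $\pi\colon P\to M$ is the projection, a surjective submersion; $\rho\colon\pi^*F\to TP$ is a bundle morphism and $\theta\in\Omega^1(P,\pi^*F)$, with $\theta\circ\rho=\mathrm{id}_{\pi^*F}$, $d\pi\circ\rho=0$, $d^\nabla\theta=\pi^*\omega$. Put $\mathcal{H}=\ker\theta$, so $TP=\mathcal{H}\oplus\ker d\pi$. Shear: with $\tilde\xi\colon\pi^*E\to\mathcal{H}$ the horizontal lift of $\xi$, put $\mathring\xi=\tilde\xi+\rho\circ\pi^*a\colon\pi^*E\to TP$; $\mathring\xi(\pi^*E)$ is an integrable distribution of constant rank, and $S=P/\mathring\xi(\pi^*E)$ is its leaf space. $\mathcal{H}$ is also complementary to $\ker d\pi_S$. For $p\in P$, $v\in T_{\pi(p)}M$ and $w\in T_{\pi_S(p)}S$ let $\tilde v,\hat w\in\mathcal{H}_p$ denote the horizontal lifts with respect to $\pi$ and $\pi_S$. $\mathcal{H}$-relatedness: $I\sim_{\mathcal{H}}I_S$ means $\widetilde{Iv}=\widehat{I_S\,d\pi_S\tilde v}$ for all $p\in P$, $v\in T_{\pi(p)}M$; for vector-valued bilinear forms, $N\sim_{\mathcal{H}}N_S$ means $\widetilde{N(v,w)}=\widehat{N_S(d\pi_S\tilde v,d\pi_S\tilde w)}$ for all $p\in P$ and $v,w\in T_{\pi(p)}M$. The Nijenhuis tensor is $N_I(X,Y)=[IX,IY]-I[IX,Y]-I[X,IY]-[X,Y]$. *)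

(* Defs.v *)
From HB Require Import structures.
From mathcomp Require Import all_boot all_order all_algebra.
From mathcomp Require Import boolp classical_sets functions cardinality reals.
From mathcomp Require Import interval_inference topology normedtype sequences landau derive.

Set Implicit Arguments.
Unset Strict Implicit.
Unset Printing Implicit Defensive.
Import Order.TTheory GRing.Theory Num.Theory numFieldNormedType.Exports.
Local Open Scope classical_set_scope.
Local Open Scope ring_scope.

Section Euclidean.
Context {R : realType}.
Implicit Types V W : normedModType R.

Definition iterD V W (f : V -> W) (vs : seq V) : V -> W :=
  foldl (fun g v => 'D_v g) f vs.

(* C^oo on a neighbourhood of x: all iterated directional derivatives exist and
   are Frechet differentiable near x. *)
Definition smooth_at V W (f : V -> W) (x : V) : Prop :=
  \forall y \near x, forall vs : seq V, differentiable (iterD f vs) y.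

Definition Ck_on V W (U : set V) (k : nat) (f : V -> W) : Prop :=
  forall vs : seq V, (size vs <= k)%N ->
    forall y, U y -> differentiable (iterD f vs) y.

Lemma smooth_atP V W (f : V -> W) x :
  smooth_at f x <->
  exists U : set V, [/\ open U, U x & forall k, Ck_on U k f].
Proof.
split=> [|[U [oU Ux fU]]]; last first.
  by apply: filterS (open_nbhs_nbhs (conj oU Ux)) => y Uy vs; exact: (fU (size vs)).
rewrite /smooth_at -nbhs_nearE nbhsE => -[U [oU Ux] Uf].
by exists U; split => // k vs _ y Uy; exact: Uf.
Qed.

Lemma near_diff V W (f g : V -> W) x :
  (\forall y \near x, f y = g y) -> differentiable f x ->
  differentiable g x /\ 'd g x = 'd f x :> (V -> W).
Proof.
move=> fg /diff_locallyP[cf Ef]; have fgx := nbhs_singleton fg.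
have E : g \o shift x = cst (g x) + 'd f x +o_ (0 : V) id.
  apply/eqaddoP => e e0.
  move/eqaddoP: Ef => /(_ e e0) Ef.
  have fg0 : \forall h \near (0 : V), f (h + x) = g (h + x).
    by move: fg; rewrite (near_shift 0) /=; apply: filterS => h; rewrite subr0.
  apply: filterS2 fg0 Ef => h fgh.
  by rewrite !fctE /= -fgx -fgh.
have dE : 'd g x = 'd f x :> (V -> W) by exact: diff_unique E.
split; last exact: dE.
by apply/diff_locallyP; split; rewrite dE; [exact: cf | exact: E].
Qed.

Lemma open_near V (U : set V) (P : V -> Prop) x : open U -> U x ->
  (forall y, U y -> P y) -> \forall y \near x, P y.
Proof. by move=> oU Ux UP; apply: filterS (open_nbhs_nbhs (conj oU Ux)). Qed.

Lemma eq_on_derive V W (U : set V) (f g : V -> W) v : open U ->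
  (forall y, U y -> f y = g y) -> forall y, U y -> 'D_v f y = 'D_v g y.
Proof.
by move=> oU fg y Uy; apply: near_eq_derive; exact: open_near oU Uy fg.
Qed.

Lemma eq_Ck_on V W (U : set V) k (f g : V -> W) : open U ->
  (forall y, U y -> f y = g y) -> Ck_on U k f -> Ck_on U k g.
Proof.
move=> oU + + vs; elim: vs k f g => [|v vs IH] k f g fg fk.
  by move=> sz y Uy; apply: (near_diff (open_near oU Uy fg) (fk [::] sz y Uy)).1.
case: k fk => // k fk; rewrite ltnS => sz.
apply: (IH k ('D_v f)) => //; first exact: eq_on_derive.
by move=> ws wsz; exact: (fk (v :: ws)).
Qed.

Lemma Ck_onS V W (U : set V) k (f : V -> W) : Ck_on U k.+1 f <->
  (forall y, U y -> differentiable f y) /\ forall v, Ck_on U k ('D_v f).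
Proof.
split=> [fk|[df fk] [|v vs] sz].
  by split=> [y Uy|v vs sz]; [exact: (fk [::]) | exact: (fk (v :: vs))].
- exact: df.
- exact: fk.
Qed.

Lemma Ck_on0 V W (U : set V) (f : V -> W) :
  (forall y, U y -> differentiable f y) -> Ck_on U 0 f.
Proof. by move=> df [|//] _. Qed.

Lemma Ck_onW V W (U : set V) k (f : V -> W) : Ck_on U k.+1 f -> Ck_on U k f.
Proof. by move=> fk vs sz; apply: fk; exact: leqW. Qed.

Lemma Ck_on_diff V W (U : set V) k (f : V -> W) y :
  Ck_on U k f -> U y -> differentiable f y.
Proof. by move=> fk; exact: (fk [::]). Qed.

Lemma Ck_onD V W (U : set V) k (f g : V -> W) : open U ->
  Ck_on U k f -> Ck_on U k g -> Ck_on U k (f + g).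
Proof.
move=> oU; elim: k f g => [|k IH] f g fk gk.
  apply: Ck_on0 => y Uy.
  by apply: differentiableD; [exact: Ck_on_diff fk Uy | exact: Ck_on_diff gk Uy].
apply/Ck_onS; split=> [y Uy|v].
  by apply: differentiableD; [exact: Ck_on_diff fk Uy | exact: Ck_on_diff gk Uy].
apply: (@eq_Ck_on _ _ _ _ ('D_v f + 'D_v g)) => // [y Uy|].
  rewrite deriveD //; apply: diff_derivable.
    exact: Ck_on_diff fk Uy.
  exact: Ck_on_diff gk Uy.
by apply: IH; [case/Ck_onS: fk | case/Ck_onS: gk].
Qed.

Lemma Ck_on_cst V W (U : set V) k (a : W) : open U -> Ck_on U k (cst a : V -> W).
Proof.
move=> oU; elim: k a => [|k IH] a; first by apply: Ck_on0 => y _.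
apply/Ck_onS; split=> // v; apply: eq_Ck_on (IH 0) => // y Uy.
by rewrite derive_cst.
Qed.

Lemma Ck_on_sum V W (U : set V) k n (f : 'I_n -> V -> W) : open U ->
  (forall i, Ck_on U k (f i)) -> Ck_on U k (\sum_(i < n) f i).
Proof.
move=> oU fk; apply: (big_ind (Ck_on U k)); last by [].
- exact: Ck_on_cst.
- by move=> f1 f2; exact: Ck_onD.
Qed.

Lemma scale_is_bilinear W :
  bilinear_for
    (GRing.Scale.Law.clone _ _ *:%R _) (GRing.Scale.Law.clone _ _ *:%R _)
    (fun (a : R) (w : W) => a *: w).
Proof.
split=> [w a x y|x a w w'] /=; first by rewrite scalerDl scalerA.
by rewrite scalerDr !scalerA mulrC.
Qed.

Lemma diff_scale V W (h : V -> R) (f : V -> W) y :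
  differentiable h y -> differentiable f y ->
  differentiable (fun z => h z *: f z) y /\
  forall v, 'D_v (fun z => h z *: f z) y = h y *: 'D_v f y + 'D_v h y *: f y.
Proof.
move=> dh df.
pose B := fun (a : R) (w : W) => a *: w.
pose BM := bilinear_isBilinear.Build R R W W _ _ B (@scale_is_bilinear W).
pose BL : {bilinear R -> W -> W} := HB.pack B BM.
have cB : continuous (fun p : R * W => BL p.1 p.2).
  by move=> p; exact: scale_continuous.
have dB := @differentiable_bilin R R W W BL (h y, f y) cB.
have dp : differentiable (fun z => (h z, f z)) y by exact: differentiable_pair.
have dhf : differentiable (fun z => h z *: f z) y.
  exact: (@differentiable_comp _ _ _ _ (fun z => (h z, f z)) (fun p => BL p.1 p.2)).
split=> // v.
rewrite (deriveE _ dhf) (deriveE _ df) (deriveE _ dh).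
have Ecomp := congr1 (fun D => D v) (diff_comp dp dB).
have Ebil := congr1 (fun D => D ('d (fun z => (h z, f z)) y v))
  (@diff_bilin R R W W BL (h y, f y) cB).
have Epair := congr1 (fun D => D v) (diff_pair dh df).
by rewrite [LHS]Ecomp /= Ebil /= Epair.
Qed.

Lemma Ck_on_scale V W (U : set V) k (h : V -> R) (f : V -> W) : open U ->
  Ck_on U k h -> Ck_on U k f -> Ck_on U k (fun y => h y *: f y).
Proof.
move=> oU; elim: k h f => [|k IH] h f hk fk.
  apply: Ck_on0 => y Uy.
  exact: (diff_scale (Ck_on_diff hk Uy) (Ck_on_diff fk Uy)).1.
apply/Ck_onS; split=> [y Uy|v].
  exact: (diff_scale (Ck_on_diff hk Uy) (Ck_on_diff fk Uy)).1.
apply: (@eq_Ck_on _ _ _ _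
  ((fun y => h y *: 'D_v f y) + (fun y => 'D_v h y *: f y))) => // [y Uy|].
  by rewrite (diff_scale (Ck_on_diff hk Uy) (Ck_on_diff fk Uy)).2.
apply: Ck_onD => //; apply: IH.
- exact: Ck_onW.
- by case/Ck_onS: fk.
- by case/Ck_onS: hk.
- exact: Ck_onW.
Qed.

Lemma diff_coord V n (f : V -> 'rV[R]_n) (i : 'I_n) y :
  differentiable f y ->
  differentiable (fun z => f z 0 i) y /\
  forall v, 'D_v (fun z => f z 0 i) y = ('D_v f y) 0 i.
Proof.
move=> df; split=> [|v].
  exact: (@differentiable_comp _ _ _ _ f (fun N : 'rV[R]_n => N 0 i : R))
           df (differentiable_coord _ _ _).
by rewrite derive_mx ?mxE //; exact: diff_derivable.
Qed.

Lemma Ck_on_coord V n (U : set V) k (f : V -> 'rV[R]_n) (i : 'I_n) : open U ->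
  Ck_on U k f -> Ck_on U k (fun y => f y 0 i).
Proof.
move=> oU; elim: k f => [|k IH] f fk.
  by apply: Ck_on0 => y Uy; exact: (diff_coord i (Ck_on_diff fk Uy)).1.
apply/Ck_onS; split=> [y Uy|v].
  exact: (diff_coord i (Ck_on_diff fk Uy)).1.
apply: (@eq_Ck_on _ _ _ _ (fun y => ('D_v f y) 0 i)) => // [y Uy|].
  by rewrite (diff_coord i (Ck_on_diff fk Uy)).2.
by apply: IH; case/Ck_onS: fk.
Qed.

Lemma derive_comp V n W (f : V -> 'rV[R]_n) (g : 'rV[R]_n -> W) y v :
  differentiable f y -> differentiable g (f y) ->
  'D_v (g \o f) y =
  \sum_(i < n) ('D_v f y) 0 i *: 'D_(delta_mx 0 i) g (f y).
Proof.
move=> df dg; rewrite deriveE; last exact: differentiable_comp.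
rewrite diff_comp //= -(deriveE _ df) [X in _ X = _]row_sum_delta linear_sum /=.
by apply: eq_bigr => i _; rewrite linearZ (deriveE _ dg).
Qed.

Lemma Ck_on_comp V n W (U : set V) (U' : set 'rV[R]_n) k
    (f : V -> 'rV[R]_n) (g : 'rV[R]_n -> W) : open U ->
  (forall y, U y -> U' (f y)) ->
  Ck_on U k f -> Ck_on U' k g -> Ck_on U k (g \o f).
Proof.
move=> oU fU; elim: k g => [|k IH] g fk gk.
  apply: Ck_on0 => y Uy; apply: differentiable_comp.
    exact: Ck_on_diff fk Uy.
  exact: Ck_on_diff gk (fU _ Uy).
apply/Ck_onS; split=> [y Uy|v].
  apply: differentiable_comp; first exact: Ck_on_diff fk Uy.
  exact: Ck_on_diff gk (fU _ Uy).
apply: (@eq_Ck_on _ _ _ _ (\sum_(i < n)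
  (fun y => ('D_v f y) 0 i *: ('D_(delta_mx 0 i) g \o f) y))) => // [y Uy|].
  rewrite fct_sumE derive_comp //; first exact: Ck_on_diff fk Uy.
  exact: Ck_on_diff gk (fU _ Uy).
apply: Ck_on_sum => // i; apply: Ck_on_scale => //.
  by apply: Ck_on_coord => //; case/Ck_onS: fk.
by apply: IH; [exact: Ck_onW | case/Ck_onS: gk].
Qed.

Lemma smooth_at_diff V W (f : V -> W) x :
  smooth_at f x -> differentiable f x.
Proof. by move=> /nbhs_singleton /(_ [::]). Qed.

Lemma smooth_at_near V W (f : V -> W) x :
  smooth_at f x -> \forall y \near x, smooth_at f y.
Proof. by rewrite /smooth_at => /near_join. Qed.

Lemma near_smooth_at V W (f g : V -> W) x :
  (\forall y \near x, f y = g y) -> smooth_at f x -> smooth_at g x.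
Proof.
rewrite -nbhs_nearE nbhsE => -[U1 [oU1 U1x] fg] /smooth_atP[U [oU Ux fU]].
apply/smooth_atP; exists (U `&` U1); split; [exact: openI | by [] | move=> k].
apply: (@eq_Ck_on _ _ _ _ f); first exact: openI.
  by move=> y [_ /fg].
by move=> vs sz y [Uy _]; exact: (fU k).
Qed.

Lemma smooth_at_comp V n W (f : V -> 'rV[R]_n) (g : 'rV[R]_n -> W) x :
  smooth_at f x -> smooth_at g (f x) -> smooth_at (g \o f) x.
Proof.
move=> sf /smooth_atP[U' [oU' U'fx gU']].
have /differentiable_continuous cf := smooth_at_diff sf.
have := cf U' (open_nbhs_nbhs (conj oU' U'fx)).
rewrite nbhsE => -[U1 [oU1 U1x] fU1].
case/smooth_atP: sf => U [oU Ux fU].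
apply/smooth_atP; exists (U `&` U1); split; [exact: openI | by [] | move=> k].
apply: (@Ck_on_comp _ _ _ _ U') => //; first exact: openI.
  by move=> y [_ /fU1].
by move=> vs sz y [Uy _]; exact: (fU k).
Qed.

Lemma smooth_at_derive V W (f : V -> W) v x :
  smooth_at f x -> smooth_at ('D_v f) x.
Proof. by apply: filterS => y fy vs; exact: (fy (v :: vs)). Qed.

End Euclidean.

(* cfwd and cbwd are total functions; only their values on cdom and on its
   image matter. *)
Record chart (R : realType) (T : topologicalType) (n : nat) := Chart {
  cdom : set T;
  cfwd : T -> 'rV[R]_n;
  cbwd : 'rV[R]_n -> T;
  open_cdom : open cdom;
  open_cim : open (cfwd @` cdom);
  cfwdK : forall x, cdom x -> cbwd (cfwd x) = x;
  cfwd_continuous : forall x, cdom x -> {for x, continuous cfwd};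
  cbwd_continuous : forall x, cdom x -> {for cfwd x, continuous cbwd} }.

(* chart_at selects one chart of the atlas around each point; it only serves to
   give tangent vectors coordinates, see TM. *)
Record manifold (R : realType) (n : nat) := Manifold {
  points :> topologicalType;
  hausdorff_points : hausdorff_space points;
  second_countable_points : @second_countable points;
  atlas : set (chart R points n);
  chart_at : points -> chart R points n;
  atlas_chart_at : forall x, atlas (chart_at x);
  chart_at_dom : forall x, cdom (chart_at x) x;
  atlas_compatible : forall c d x, atlas c -> atlas d -> cdom c x -> cdom d x ->
    smooth_at (cfwd d \o cbwd c) (cfwd c x) }.

(* Local functions, sections and vector fields are encoded as total ones that
   are smooth near the point under consideration. *)
Definition msmooth_at (R : realType) n (M : manifold R n) (W : normedModType R)
    (f : M -> W) (x : M) : Prop :=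
  forall c, atlas c -> cdom c x -> smooth_at (f \o cbwd c) (cfwd c x).

Record smooth_map (R : realType) n k (N : manifold R n) (M : manifold R k) :=
  SmoothMap {
  smap :> N -> M;
  smap_continuous : continuous smap;
  smap_smooth : forall x c d, atlas c -> cdom c x -> atlas d -> cdom d (smap x) ->
    smooth_at (cfwd d \o smap \o cbwd c) (cfwd c x) }.

(* tcoord is the fibrewise isomorphism onto 'rV_r and tframe its inverse. *)
Record local_triv (R : realType) n (M : manifold R n) (E : M -> lmodType R)
    (r : nat) := LocalTriv {
  tdom : set M;
  tcoord : forall x, {linear E x -> 'rV[R]_r};
  tframe : forall x, 'rV[R]_r -> E x;
  open_tdom : open tdom;
  tcoordK : forall x, tdom x -> cancel (tcoord x) (tframe x);
  tframeK : forall x, tdom x -> cancel (tframe x) (tcoord x) }.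

Record vbundle (R : realType) n (M : manifold R n) (r : nat) := VBundle {
  fib :> M -> lmodType R;
  trivs : set (local_triv fib r);
  trivs_cover : forall x, exists2 t, trivs t & tdom t x;
  trivs_compatible : forall s t x u, trivs s -> trivs t -> tdom s x -> tdom t x ->
    msmooth_at (fun y => tcoord t y (tframe s y u)) x }.

Definition section (R : realType) n (M : manifold R n) r (E : vbundle M r) :=
  forall x, E x.

Definition smooth_sec (R : realType) n (M : manifold R n) r (E : vbundle M r)
    (s : section E) (x : M) : Prop :=
  forall t, trivs t -> tdom t x -> msmooth_at (fun y => tcoord t y (s y)) x.

Section Lemmas.
Context {R : realType}.

Lemma near_cbwd n (M : manifold R n) (c : chart R M n) (x : M) (P : M -> Prop) :
  cdom c x -> (\forall y \near x, P y) -> \forall z \near cfwd c x, P (cbwd c z).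
Proof. by move=> cx Px; apply: cbwd_continuous => //; rewrite cfwdK. Qed.

Lemma near_cdom n (M : manifold R n) (c : chart R M n) (x : M) :
  cdom c x -> \forall z \near cfwd c x, cdom c (cbwd c z) /\ cfwd c (cbwd c z) = z.
Proof.
move=> cx; have : nbhs (cfwd c x) (cfwd c @` cdom c).
  by apply: open_nbhs_nbhs; split; [exact: open_cim | exists x].
by apply: filterS => z [y cy <-]; rewrite cfwdK.
Qed.

Lemma near_open (T : topologicalType) (U : set T) x : open U -> U x ->
  \forall y \near x, U y.
Proof. by move=> oU Ux; exact: open_nbhs_nbhs. Qed.

Definition transition_diff n (M : manifold R n) (c d : chart R M n) (x : M) :
    {linear 'rV[R]_n -> 'rV[R]_n} :=
  'd (cfwd d \o cbwd c) (cfwd c x).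

Lemma transition_diff_id n (M : manifold R n) (c : chart R M n) x u :
  cdom c x -> transition_diff c c x u = u.
Proof.
move=> cx.
have E : \forall z \near cfwd c x, id z = (cfwd c \o cbwd c) z.
  by apply: filterS (near_cdom cx) => z [_ /= ->].
have did : differentiable (@id 'rV[R]_n) (cfwd c x) by [].
have D1 := congr1 (fun D => D u) (near_diff E did).2.
apply: (etrans D1).
by rewrite diff_val.
Qed.

Lemma transition_diff_comp n (M : manifold R n) (c d e : chart R M n) x u :
  atlas c -> atlas d -> atlas e -> cdom c x -> cdom d x -> cdom e x ->
  transition_diff d e x (transition_diff c d x u) = transition_diff c e x u.
Proof.
move=> ac ad ae cx dx ex.
have scd := atlas_compatible ac ad cx dx.
have sde := atlas_compatible ad ae dx ex.
have E : \forall z \near cfwd c x,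
    ((cfwd e \o cbwd d) \o (cfwd d \o cbwd c)) z = (cfwd e \o cbwd c) z.
  have := near_cbwd cx (near_open (open_cdom d) dx).
  by apply: filterS => z dz /=; rewrite cfwdK.
have dcd := smooth_at_diff scd.
have Ex : (cfwd d \o cbwd c) (cfwd c x) = cfwd d x by rewrite /= cfwdK.
have dde : differentiable (cfwd e \o cbwd d) ((cfwd d \o cbwd c) (cfwd c x)).
  by rewrite Ex; exact: smooth_at_diff.
have D1 := congr1 (fun D => D u) (near_diff E (differentiable_comp dcd dde)).2.
have D2 := congr1 (fun D => D u) (diff_comp dcd dde).
apply: esym; apply: (etrans D1); apply: (etrans D2).
rewrite /transition_diff -[in RHS]Ex; exact: erefl.
Qed.

Lemma msmooth_at_comp n k (N : manifold R n) (M : manifold R k)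
    (phi : smooth_map N M) (W : normedModType R) (f : M -> W) x :
  msmooth_at f (phi x) -> msmooth_at (f \o phi) x.
Proof.
move=> sf c ac cx.
have ad := atlas_chart_at (phi x); have dx := chart_at_dom (phi x).
set d := chart_at (phi x) in ad dx.
have E : \forall z \near cfwd c x,
    ((f \o cbwd d) \o (cfwd d \o phi \o cbwd c)) z = ((f \o phi) \o cbwd c) z.
  have : \forall y \near x, cdom d (phi y).
    by apply: (@smap_continuous _ _ _ _ _ phi x); exact: near_open (open_cdom d) dx.
  by move=> /(near_cbwd cx); apply: filterS => z dz /=; rewrite cfwdK.
apply: near_smooth_at E _; apply: smooth_at_comp.
  exact: smap_smooth.
by rewrite /= cfwdK //; exact: sf.
Qed.

End Lemmas.

Section Tangent.
Context {R : realType} {n : nat} (M : manifold R n).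

Lemma tangent_coordK (c d : chart R M n) x :
  atlas c -> atlas d -> cdom c x -> cdom d x ->
  cancel (transition_diff c d x) (transition_diff d c x).
Proof.
move=> ac ad cx dx u.
by rewrite transition_diff_comp // transition_diff_id.
Qed.

(* A tangent vector at x is represented by its components in chart_at x; a chart
   c trivialises the bundle through the Jacobian of the change of coordinates. *)
Definition tangent_triv (c : chart R M n) (ac : atlas c) :
    local_triv (fun _ : M => 'rV[R]_n : lmodType R) n :=
  @LocalTriv R n M (fun _ => 'rV[R]_n : lmodType R) n (cdom c)
    (fun x => transition_diff (chart_at x) c x)
    (fun x => transition_diff c (chart_at x) x) (open_cdom c)
    (fun x cx => tangent_coordK (atlas_chart_at x) ac (chart_at_dom x) cx)
    (fun x cx => tangent_coordK ac (atlas_chart_at x) cx (chart_at_dom x)).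

Definition tangent_trivs : set (local_triv (fun _ : M => 'rV[R]_n : lmodType R) n) :=
  [set t | exists c (ac : atlas c), t = tangent_triv ac].

Lemma tangent_cover x : exists2 t, tangent_trivs t & tdom t x.
Proof.
exists (tangent_triv (atlas_chart_at x)); last exact: chart_at_dom.
by exists (chart_at x), (atlas_chart_at x).
Qed.

Lemma tangent_compatible s t x u :
  tangent_trivs s -> tangent_trivs t -> tdom s x -> tdom t x ->
  msmooth_at (fun y => tcoord t y (tframe s y u)) x.
Proof.
move=> [c [ac ->]] [d [ad ->]] cx dx e ae ex.
have E : \forall z \near cfwd e x,
    ('D_u (cfwd d \o cbwd c) \o (cfwd c \o cbwd e)) z =
    ((fun y => tcoord (tangent_triv ad) y (tframe (tangent_triv ac) y u))
       \o cbwd e) z.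
  apply: filterS2 (near_cbwd ex (near_open (open_cdom c) cx))
                  (near_cbwd ex (near_open (open_cdom d) dx)) => z cz dz.
  have dcd := smooth_at_diff (atlas_compatible ac ad cz dz).
  apply: (etrans (deriveE u dcd)); apply: esym.
  exact: (transition_diff_comp u ac (atlas_chart_at _) ad cz (chart_at_dom _) dz).
apply: near_smooth_at E _; apply: smooth_at_comp; first exact: atlas_compatible.
by rewrite /= cfwdK //; apply: smooth_at_derive; exact: atlas_compatible.
Qed.

Definition TM : vbundle M n := VBundle tangent_cover tangent_compatible.

End Tangent.

Section Pullback.
Context {R : realType} {n k r : nat} {N : manifold R n} {M : manifold R k}.
Context (phi : smooth_map N M) (E : vbundle M r).

Lemma open_pullback (t : local_triv E r) : open (phi @^-1` tdom t).
Proof.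
by apply: open_comp (open_tdom t) => x _; exact: smap_continuous.
Qed.

Definition pullback_triv (t : local_triv E r) :
    local_triv (fun p : N => E (phi p)) r :=
  @LocalTriv R n N (fun p => E (phi p)) r (phi @^-1` tdom t)
    (fun p => tcoord t (phi p)) (fun p => tframe t (phi p)) (open_pullback t)
    (fun p => @tcoordK _ _ _ _ _ t (phi p)) (fun p => @tframeK _ _ _ _ _ t (phi p)).

Definition pullback_trivs : set (local_triv (fun p : N => E (phi p)) r) :=
  [set pullback_triv t | t in @trivs _ _ _ _ E].

Lemma pullback_cover p : exists2 t, pullback_trivs t & tdom t p.
Proof.
have [t Et tp] := trivs_cover E (phi p).
by exists (pullback_triv t) => //; exists t.
Qed.

Lemma pullback_compatible s t p u :
  pullback_trivs s -> pullback_trivs t -> tdom s p -> tdom t p ->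
  msmooth_at (fun q => tcoord t q (tframe s q u)) p.
Proof.
move=> [s0 Es <-] [t0 Et <-] sp tp.
exact: (msmooth_at_comp (trivs_compatible u Es Et sp tp)).
Qed.

Definition pullback : vbundle N r := VBundle pullback_cover pullback_compatible.

End Pullback.

Section Extension.
Context {R : realType} {n r : nat} {M : manifold R n} (E : vbundle M r).

Lemma msmooth_at_cst (W : normedModType R) (w : W) (x : M) :
  msmooth_at (fun=> w) x.
Proof.
move=> c _ _; apply/smooth_atP; exists setT; split => //; first exact: openT.
by move=> k; apply: Ck_on_cst; exact: openT.
Qed.

Lemma section_through (x : M) (v : E x) :
  exists s : section E, smooth_sec s x /\ s x = v.
Proof.
have [t Et tx] := trivs_cover E x.
exists (fun y => tframe t y (tcoord t x v)); split; last by rewrite tcoordK.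
by move=> s Es sx; exact: trivs_compatible.
Qed.

(* An arbitrary local section, smooth near x, with value v at x. *)
Definition extend (x : M) (v : E x) : section E := projT1 (cid (section_through v)).
Arguments extend x v : clear implicits.

End Extension.

Record bundle_hom (R : realType) n (M : manifold R n) r k (E : vbundle M r)
    (E' : vbundle M k) := BundleHom {
  happ :> forall x, {linear E x -> E' x};
  happ_smooth : forall x (s : section E), smooth_sec s x ->
    smooth_sec (fun y => happ y (s y) : E' y) x }.

Record form2 (R : realType) n (M : manifold R n) r (F : vbundle M r) := Form2 {
  fapp :> forall x, {bilinear TM M x -> TM M x -> F x};
  fapp_alternating : forall x v, fapp x v v = 0;
  fapp_smooth : forall x (X Y : section (TM M)), smooth_sec X x -> smooth_sec Y x ->
    smooth_sec (fun y => fapp y (X y) (Y y) : F y) x }.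

Section Calculus.
Context {R : realType} {n : nat} {M : manifold R n}.

(* The derivative of f along a tangent vector at x. *)
Definition dfun (W : normedModType R) (f : M -> W) (x : M) : {linear TM M x -> W} :=
  'd (f \o cbwd (chart_at x)) (cfwd (chart_at x) x).

(* [X, Y]^j = X(Y^j) - Y(X^j), where X^j and Y^j are the components in the
   coordinates u of chart_at x. *)
Definition bracket (X Y : section (TM M)) : section (TM M) := fun x =>
  let u := cfwd (chart_at x) in
  dfun (fun y => dfun u y (Y y)) x (X x) - dfun (fun y => dfun u y (X y)) x (Y x).

Definition tmap k (N : manifold R k) (phi : smooth_map M N) (x : M) :
    {linear TM M x -> TM N (phi x)} :=
  'd (cfwd (chart_at (phi x)) \o phi \o cbwd (chart_at x)) (cfwd (chart_at x) x).

(* nabla v s is only constrained when s is smooth near the base point of v. *)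
Record connection r (E : vbundle M r) := Connection {
  nabla :> forall x, TM M x -> section E -> E x;
  nabla_linear : forall x (s : section E), smooth_sec s x ->
    linear (fun v : TM M x => @nabla x v s);
  nablaD : forall x (v : TM M x) (s t : section E), smooth_sec s x -> smooth_sec t x ->
    @nabla x v (fun y => s y + t y) = @nabla x v s + @nabla x v t;
  nabla_leibniz : forall x (v : TM M x) (f : M -> R) (s : section E),
    msmooth_at f x -> smooth_sec s x ->
    @nabla x v (fun y => f y *: s y) = dfun f x v *: s x + f x *: @nabla x v s;
  nabla_smooth : forall x (X : section (TM M)) (s : section E),
    smooth_sec X x -> smooth_sec s x -> smooth_sec (fun y => @nabla y (X y) s) x }.

(* D_X D_Y s - D_Y D_X s - D_[X, Y] s = 0 *)
Definition is_flat r (E : vbundle M r) (D : connection E) : Prop :=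
  forall x (X Y : section (TM M)) (s : section E),
    smooth_sec X x -> smooth_sec Y x -> smooth_sec s x ->
    D x (X x) (fun y => D y (Y y) s) - D x (Y x) (fun y => D y (X y) s)
      - D x (bracket X Y x) s = 0.

End Calculus.

Record flat_bundle (R : realType) n (M : manifold R n) r := FlatBundle {
  fbundle :> vbundle M r;
  fconn : connection fbundle;
  fconn_flat : is_flat fconn }.

Section ExteriorDerivative.
Context {R : realType} {n : nat} {M : manifold R n} {r : nat}.

(* The covariant exterior derivative of a section of Hom(E, F), of a 1-form and
   of a 2-form. *)
Definition dnabla0 k (E : vbundle M r) (F : vbundle M k) (DE : connection E)
    (DF : connection F) (a : bundle_hom E F) (x : M) (v : TM M x) (e : section E) :
    F x :=
  DF x v (fun y => a y (e y)) - a x (DE x v e).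

Definition dnabla1 (F : vbundle M r) (D : connection F)
    (theta : bundle_hom (TM M) F) (X Y : section (TM M)) (x : M) : F x :=
  D x (X x) (fun y => theta y (Y y)) - D x (Y x) (fun y => theta y (X y))
    - theta x (bracket X Y x).

Definition dnabla2 (F : vbundle M r) (D : connection F) (omega : form2 F)
    (X Y Z : section (TM M)) (x : M) : F x :=
  D x (X x) (fun y => omega y (Y y) (Z y))
    - D x (Y x) (fun y => omega y (X y) (Z y))
    + D x (Z x) (fun y => omega y (X y) (Y y))
    - omega x (bracket X Y x) (Z x) + omega x (bracket X Z x) (Y x)
    - omega x (bracket Y Z x) (X x).

End ExteriorDerivative.

Record shear_data (R : realType) n (M : manifold R n) r (E F : flat_bundle M r) :=
  ShearData {
  xi : bundle_hom E (TM M);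
  amap : bundle_hom E F;
  ainv : bundle_hom F E;
  omega : form2 F;
  amapK : forall x, cancel (amap x) (ainv x);
  ainvK : forall x, cancel (ainv x) (amap x);
  xi_bracket : forall x (e1 e2 : section E), smooth_sec e1 x -> smooth_sec e2 x ->
    xi x (fconn E x (xi x (e1 x)) e2 - fconn E x (xi x (e2 x)) e1) =
    bracket (fun y => xi y (e1 y)) (fun y => xi y (e2 y)) x;
  omega_closed : forall x (X Y Z : section (TM M)),
    smooth_sec X x -> smooth_sec Y x -> smooth_sec Z x ->
    dnabla2 (fconn F) omega X Y Z x = 0;
  xi_omega : forall x (v : TM M x) (e : section E), smooth_sec e x ->
    omega x (xi x (e x)) v = - dnabla0 (fconn E) (fconn F) amap v e;
  xi_xi_omega : forall x (e1 e2 : E x), omega x (xi x e1) (xi x e2) = 0 }.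

(* phi is the projection onto the smooth leaf space of a foliation: the leaves
   are the fibres of phi, so they are tangent to the kernel of its differential. *)
Definition is_leaf_projection (R : realType) n k (P : manifold R n) (B : manifold R k)
    (phi : smooth_map P B) : Prop :=
  [/\ forall b, exists p, phi p = b,
      forall p (w : TM B (phi p)), exists v, tmap phi p v = w
    & forall b, connected (phi @^-1` [set b])].

Definition is_pullback_connection (R : realType) n k r (P : manifold R n)
    (M : manifold R k) (phi : smooth_map P M) (F : vbundle M r) (D : connection F)
    (D' : connection (pullback phi F)) : Prop :=
  forall p (v : TM P p) (s : section F), smooth_sec s (phi p) ->
    D' p v (fun q => s (phi q)) = D (phi p) (tmap phi p v) s.

(* proj_dim says that the leaves have dimension r, the rank of F. *)
Record total_space (R : realType) n (M : manifold R n) r (E F : flat_bundle M r)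
    (sd : shear_data E F) (k : nat) (P : manifold R k) := TotalSpace {
  proj : smooth_map P M;
  proj_leaf : is_leaf_projection proj;
  proj_dim : k = (n + r)%N;
  rho : bundle_hom (pullback proj F) (TM P);
  theta : bundle_hom (TM P) (pullback proj F);
  theta_rho : forall p (f : F (proj p)), theta p (rho p f) = f;
  proj_rho : forall p (f : F (proj p)), tmap proj p (rho p f) = 0;
  pconn : connection (pullback proj F);
  pconn_pullback : is_pullback_connection (fconn F) pconn;
  dtheta : forall p (X Y : section (TM P)), smooth_sec X p -> smooth_sec Y p ->
    dnabla1 pconn theta X Y p =
    omega sd (proj p) (tmap proj p (X p)) (tmap proj p (Y p)) }.

Section Shear.
Context {R : realType} {n r k : nat} {M : manifold R n} {E F : flat_bundle M r}
  {sd : shear_data E F} {P : manifold R k} (T : total_space sd P).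

(* The horizontal lift: the vector of H = ker theta over w; the default value 0
   is used only if there is none. *)
Definition hlift m (B : manifold R m) (phi : smooth_map P B) (p : P)
    (w : TM B (phi p)) : TM P p :=
  xget 0 [set h | theta T p h = 0 /\ tmap phi p h = w].

Arguments hlift {m B} phi p w.

Definition xi_ring (p : P) (e : E (proj T p)) : TM P p :=
  hlift (proj T) p (xi sd (proj T p) e) + rho T p (amap sd (proj T p) e).

Arguments xi_ring p e : clear implicits.

(* S is the leaf space of the distribution with fibre the range of xi_ring p. *)
Record shear m (S : manifold R m) := Shear {
  sproj : smooth_map P S;
  sproj_leaf : is_leaf_projection sproj;
  sproj_ker : forall p (v : TM P p),
    tmap sproj p v = 0 <-> exists e, v = xi_ring p e }.

Definition hrel_endo m (S : manifold R m) (sh : shear S)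
    (A : bundle_hom (TM M) (TM M)) (A' : bundle_hom (TM S) (TM S)) : Prop :=
  forall p (v : TM M (proj T p)),
    hlift (proj T) p (A (proj T p) v) =
    hlift (sproj sh) p (A' (sproj sh p) (tmap (sproj sh) p (hlift (proj T) p v))).

Definition hrel_form m (S : manifold R m) (sh : shear S)
    (N : forall x, TM M x -> TM M x -> TM M x)
    (N' : forall y, TM S y -> TM S y -> TM S y) : Prop :=
  forall p (v w : TM M (proj T p)),
    hlift (proj T) p (N (proj T p) v w) =
    hlift (sproj sh) p (N' (sproj sh p)
      (tmap (sproj sh) p (hlift (proj T) p v))
      (tmap (sproj sh) p (hlift (proj T) p w))).

End Shear.

Record almost_complex (R : realType) n (M : manifold R n) := AlmostComplex {
  acs :> bundle_hom (TM M) (TM M);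
  acs_sqr : forall x v, acs x (acs x v) = - v }.

Definition nijenhuis_field (R : realType) n (M : manifold R n) (I : almost_complex M)
    (X Y : section (TM M)) : section (TM M) := fun x =>
  let IX : section (TM M) := fun y => I y (X y) in
  let IY : section (TM M) := fun y => I y (Y y) in
  bracket IX IY x - I x (bracket IX Y x) - I x (bracket X IY x) - bracket X Y x.

(* The value does not depend on the extensions, the formula being tensorial. *)
Definition nijenhuis (R : realType) n (M : manifold R n) (I : almost_complex M)
    (x : M) (v w : TM M x) : TM M x :=
  nijenhuis_field I (@extend _ _ _ _ (TM M) x v) (@extend _ _ _ _ (TM M) x w) x.

Arguments nijenhuis {R n M} I x v w.

Definition xi_ainv_omega (R : realType) n (M : manifold R n) r (E F : flat_bundle M r)
    (sd : shear_data E F) (x : M) (v w : TM M x) : TM M x :=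
  xi sd x (ainv sd x (omega sd x v w)).

Arguments xi_ainv_omega {R n M r E F} sd x v w.

(* Main.v *)
From HB Require Import structures.
Require Import Defs.
From mathcomp Require Import all_boot all_order all_algebra.
From mathcomp Require Import boolp classical_sets functions reals.
From mathcomp Require Import topology normedtype landau derive.
From mathcomp Require Import ring ssrAC.

(** The Nijenhuis tensor is a pointwise expression in the 1-jet of the almost
    complex structure [I], so it can be read off from vector fields on a total
    space mapping to the manifold, even when these fields are not projectable.
    If [phi : P -> B] is smooth and [U, V, U', V'] are fields on [P] with
    [dphi U' = I dphi U] and [dphi V' = I dphi V], then
      [dphi [U', V'] - I dphi [U', V] - I dphi [U, V'] - dphi [U, V]]
    equals [N_I (dphi U, dphi V)]: in coordinates [u, v] of [dphi U, dphi V] one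
    has [dphi [U, V] = U v - V u] (this is where the symmetry of second
    derivatives enters, see [tmap_bracket]), and in the combination above every
    derivative of [u] and [v] cancels because [I^2 = -1]; what remains are
    derivatives of [I] ([nijenhuis_jet_along]).  The case [phi = id] identifies
    this remainder with the Nijenhuis tensor ([nijenhuisE]).

    Since [I] and [I_S] are H-related, one and the same quadruple serves both
    projections of [P].  Extend two horizontal vectors at [p] to horizontal
    fields [U, V], and let [J X] be the horizontal lift of [I (dpi X)]: it
    satisfies [dpi (J X) = I (dpi X)], and H-relatedness says exactly that
    [dpi_S (J X) = I_S (dpi_S X)].  So [N_I] and [N_{I_S}] are both computed
    from the brackets of [U, V, J U, J V].

    It remains to compare [dpi Z] with [dpi_S Z] for the bracket [Z] of two
    horizontal fields [X, Y].  Its vertical part is [rho (theta Z)] with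
    [theta Z = - omega (dpi X, dpi Y)] by the structure equation of [theta], and
    [dpi_S] kills [xi~ e + rho (a e)], hence sends [rho f] to minus the image
    of the horizontal lift of [xi (a^-1 f)].  Therefore [dpi_S Z] corresponds
    under H to [dpi Z + F (dpi X, dpi Y)] ([tmap_sproj_bracket]), and
    substituting this in the four brackets yields the four terms in [F].

    The analytic inputs are the symmetry of second derivatives ([derive_comm])
    and the smoothness of horizontal lifts ([smooth_sec_of_images]), which are
    solutions of a linear system with smooth coefficients. *)

Set Implicit Arguments.
Unset Strict Implicit.
Unset Printing Implicit Defensive.
Import Order.TTheory GRing.Theory Num.Theory numFieldNormedType.Exports.
Local Open Scope classical_set_scope.
Local Open Scope ring_scope.

(** * Symmetry of second derivatives *)

Section Schwarz.
Context {R : realType} {V : normedModType R}.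
Implicit Types (f : V -> R) (x y u v : V).

Lemma is_derive_line f y u (s : R) : differentiable f (s *: u + y) ->
  is_derive s 1 (fun t : R => f (t *: u + y)) ('D_u f (s *: u + y)).
Proof.
move=> df.
have E : (fun h : R => h^-1 *: (((fun t : R => f (t *: u + y)) \o shift s) (h *: 1)
            - f (s *: u + y))) =
         (fun h : R => h^-1 *: ((f \o shift (s *: u + y)) (h *: u) - f (s *: u + y))).
  apply/funext => h /=; congr (_ *: (f _ - _)).
  by rewrite [h *: 1]mulr1 scalerDl addrA.
split; first by rewrite /derivable E; exact: diff_derivable.
by rewrite /derive E.
Qed.

Definition second_difference f x u v (h : R) : R :=
  f (h *: u + (h *: v + x)) - f (h *: v + x) - f (h *: u + x) + f x.

Lemma second_differenceC f x u v h :
  second_difference f x u v h = second_difference f x v u h.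
Proof. by rewrite /second_difference addrCA [_ - f (h *: u + x)]addrAC. Qed.

(** The mean value theorem in the direction [u] turns the second difference into
    [h] times an increment of ['D_u f] along [h v], up to points at distance
    [O(h)] from [x]; the differentiability of ['D_u f] at [x] then
    linearises the increment. *)
Lemma second_difference_near f x u v (e : R) :
  (\forall y \near x, differentiable f y) -> differentiable ('D_u f) x -> 0 < e ->
  exists2 d : R, 0 < d & forall h : R, 0 < h < d ->
    `|second_difference f x u v h - h ^+ 2 * 'D_v ('D_u f) x| <= e * h ^+ 2.
Proof.
move=> fd gd e0.
(* All points involved lie within h * C of x; the constant 1 makes C positive,
   and the factor 2 in e' accounts for the two remainders. *)
pose C : R := `|u| + `|v| + 1.
have C0 : 0 < C by rewrite ltr_wpDl ?ltr01 ?addr_ge0.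
pose e' := e / (2 * C).
have e'0 : 0 < e' by rewrite divr_gt0 ?mulr_gt0.
pose L := 'd ('D_u f) x.
have Eg : \forall k \near (0 : V),
    differentiable f (k + x) /\ `|'D_u f (k + x) - 'D_u f x - L k| <= e' * `|k|.
  apply: filter_app (_ : \forall k \near (0 : V), differentiable f (k + x)).
    have /diff_locally/eqaddoP/(_ _ e'0) := gd.
    apply: filterS => k /= kE fk; split => //.
    by move: kE; rewrite !fctE opprD addrA.
  by move: fd; rewrite (near_shift 0) /=; apply: filterS => h; rewrite subr0.
have /nbhs_normP[d /= d0 Ed] := Eg.
exists (d / C); first exact: divr_gt0.
move=> h /andP[h0 hd].
have bnd k : `|k| <= h * C -> differentiable f (k + x) /\
    `|'D_u f (k + x) - 'D_u f x - L k| <= e' * `|k|.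
  move=> kh; apply: Ed; rewrite /= sub0r normrN (le_lt_trans kh) //.
  by rewrite -ltr_pdivlMr.
have b1 (s : R) : 0 <= s <= h -> `|s *: u + h *: v| <= h * C.
  move=> /andP[s0 sh]; apply: (le_trans (ler_normD _ _)).
  rewrite !normrZ (ger0_norm s0) (gtr0_norm h0) /C !mulrDr.
  by rewrite -addrA lerD // ?ler_wpM2r // mulr1 lerDl ltW.
have b0 (s : R) : 0 <= s <= h -> `|s *: u| <= h * C.
  move=> /andP[s0 sh]; rewrite normrZ (ger0_norm s0) /C !mulrDr.
  rewrite -addrA; apply: (le_trans (ler_wpM2r (normr_ge0 u) sh)).
  by rewrite lerDl mulr1 addr_ge0 ?mulr_ge0 // ltW.
pose G (t : R) := f (t *: u + (h *: v + x)) - f (t *: u + x).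
pose dG (t : R) := 'D_u f (t *: u + (h *: v + x)) - 'D_u f (t *: u + x).
have GD t : 0 <= t <= h -> is_derive t 1 G (dG t).
  move=> th; apply: is_deriveB.
    by apply: is_derive_line; rewrite addrA; case: (bnd _ (b1 _ th)).
  by apply: is_derive_line; case: (bnd _ (b0 _ th)).
have [t th EG] : exists2 t, t \in `]0, h[%R & G h - G 0 = dG t * (h - 0).
  apply: MVT => // [t|].
    by rewrite in_itv /= => /andP[t0 t1]; apply: GD; rewrite !ltW.
  apply: derivable_within_continuous => t; rewrite in_itv /= => th.
  exact: (@ex_derive _ _ _ _ _ _ _ (GD t th)).
move: th; rewrite in_itv /= => /andP[/ltW t0 /ltW t1].
have th : 0 <= t <= h by rewrite t0.
have -> : second_difference f x u v h = dG t * h.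
  rewrite -[h in RHS]subr0 -EG /G !scale0r !add0r /second_difference.
  move: (f (h *: u + (h *: v + x))) (f (h *: v + x)) (f (h *: u + x)) (f x) => /= f1 f2 f3 f4.
  by rewrite opprB [RHS]addrA [RHS]addrAC; congr (_ + _); rewrite addrAC.
have [_ B1] := bnd _ (b1 _ th); have [_ B0] := bnd _ (b0 _ th).
have Ev : 'D_v ('D_u f) x = L v by rewrite deriveE.
rewrite Ev.
have -> : dG t * h - h ^+ 2 * L v =
    h * (('D_u f (t *: u + h *: v + x) - 'D_u f x - L (t *: u + h *: v))
      - ('D_u f (t *: u + x) - 'D_u f x - L (t *: u))).
  rewrite /dG addrA linearD (linearZZ L h v) -[h *: L v]/(h * L v).
  move: ('D_u f (t *: u + h *: v + x)) ('D_u f (t *: u + x)) ('D_u f x) => /= f1 f2 f3.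
  move: (L v) (L (t *: u)) => /= l1 l2.
  ring.
rewrite normrM (gtr0_norm h0) [e * _]mulrC expr2 -mulrA ler_pM2l //.
apply: (le_trans (ler_normB _ _)).
apply: (le_trans (lerD B1 B0)); rewrite -mulrDr.
apply: (@le_trans _ _ (e' * (h * C + h * C))).
  by rewrite ler_pM2l // lerD // ?b0 // ?b1.
rewrite /e' -mulr2n -[h * C *+ 2]mulr_natl [X in X <= _](_ : _ = h * e) //.
by field; rewrite gt_eqF.
Qed.

(** The second difference is symmetric in [u] and [v], and both iterated
    derivatives are its limit divided by [h ^+ 2]. *)
Lemma derive_comm f x u v :
  (\forall y \near x, differentiable f y) ->
  differentiable ('D_u f) x -> differentiable ('D_v f) x ->
  'D_v ('D_u f) x = 'D_u ('D_v f) x.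
Proof.
move=> fd ud vd; apply/eqP; rewrite -subr_eq0 -normr_le0.
apply/ler_addgt0Pl => e e0; rewrite addr0.
have e20 : 0 < e / 2 by rewrite divr_gt0.
have [d1 d10 H1] := second_difference_near v fd ud e20.
have [d2 d20 H2] := second_difference_near u fd vd e20.
pose h := Num.min d1 d2 / 2.
have m0 : 0 < Num.min d1 d2 by rewrite lt_min d10.
have h0 : 0 < h by rewrite divr_gt0.
have hm : h < Num.min d1 d2 by rewrite /h ltr_pdivrMr // mulr_natr mulr2n ltrDl.
move: (hm); rewrite lt_min => /andP[hd1 hd2].
have {}H1 := H1 h; have {}H2 := H2 h.
rewrite second_differenceC h0 hd1 in H1; rewrite h0 hd2 in H2.
have H := lerD (H2 isT) (H1 isT); rewrite -mulrDl -splitr in H.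
have {H} := le_trans (ler_normB _ _) H.
move: (second_difference f x v u h) ('D_v _ x) ('D_u _ x) => /= s a b.
rewrite (_ : _ - _ = h ^+ 2 * (a - b)); last by ring.
by rewrite normrM ger0_norm ?sqr_ge0 // mulrC ler_pM2r // exprn_gt0.
Qed.

End Schwarz.

(** * Calculus of smooth functions *)

Section SmoothFunctions.
Context {R : realType}.
Implicit Types V W : normedModType R.

Lemma smooth_at_meet V W1 W2 (f : V -> W1) (g : V -> W2) x :
  smooth_at f x -> smooth_at g x ->
  exists U, [/\ open U, U x & forall k, Ck_on U k f /\ Ck_on U k g].
Proof.
move=> /smooth_atP[U1 [oU1 x1 f1]] /smooth_atP[U2 [oU2 x2 g2]].
exists (U1 `&` U2); split; [exact: openI | by [] | move=> k].
by split=> vs sz y [y1 y2]; [exact: (f1 k) | exact: (g2 k)].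
Qed.

Lemma smooth_at_cst V W (w : W) (x : V) : smooth_at (fun=> w) x.
Proof.
by apply/smooth_atP; exists setT; split=> [||k]; [exact: openT| |exact: Ck_on_cst openT].
Qed.

Lemma smooth_atD V W (f g : V -> W) x :
  smooth_at f x -> smooth_at g x -> smooth_at (fun y => f y + g y) x.
Proof.
move=> sf sg; have [U [oU Ux H]] := smooth_at_meet sf sg.
by apply/smooth_atP; exists U; split=> // k; case: (H k); exact: Ck_onD.
Qed.

Lemma smooth_at_scale V W (h : V -> R) (f : V -> W) x :
  smooth_at h x -> smooth_at f x -> smooth_at (fun y => h y *: f y) x.
Proof.
move=> sh sf; have [U [oU Ux H]] := smooth_at_meet sh sf.
by apply/smooth_atP; exists U; split=> // k; case: (H k); exact: Ck_on_scale.
Qed.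

Lemma smooth_atM V (f g : V -> R) x :
  smooth_at f x -> smooth_at g x -> smooth_at (fun y => f y * g y) x.
Proof. exact: smooth_at_scale. Qed.

Lemma smooth_at_sum V W (J : Type) (s : seq J) (F : J -> V -> W) x :
  (forall i, smooth_at (F i) x) -> smooth_at (fun y => \sum_(i <- s) F i y) x.
Proof.
move=> sF; elim: s => [|i s IH].
  by under eq_fun do rewrite big_nil; exact: smooth_at_cst.
by under eq_fun do rewrite big_cons; exact: smooth_atD.
Qed.

Lemma smooth_at_prod V (J : Type) (s : seq J) (F : J -> V -> R) x :
  (forall i, smooth_at (F i) x) -> smooth_at (fun y => \prod_(i <- s) F i y) x.
Proof.
move=> sF; elim: s => [|i s IH].
  by under eq_fun do rewrite big_nil; exact: smooth_at_cst.
by under eq_fun do rewrite big_cons; exact: smooth_atM.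
Qed.

Lemma smooth_at_coord V n (f : V -> 'rV[R]_n) (i : 'I_n) x :
  smooth_at f x -> smooth_at (fun y => f y 0 i) x.
Proof.
move=> /smooth_atP[U [oU Ux H]]; apply/smooth_atP; exists U; split=> // k.
exact: Ck_on_coord.
Qed.

Lemma smooth_at_row V n (f : V -> 'rV[R]_n) x :
  (forall i, smooth_at (fun y => f y 0 i) x) -> smooth_at f x.
Proof.
move=> sf; rewrite (_ : f = fun y => \sum_i f y 0 i *: delta_mx 0 i).
  by apply: smooth_at_sum => i; apply: smooth_at_scale => //; exact: smooth_at_cst.
by apply/funext => y; exact: row_sum_delta.
Qed.

Lemma near_neq0 V (h : V -> R) x :
  differentiable h x -> h x != 0 -> \forall y \near x, h y != 0.
Proof.
move=> /differentiable_continuous ch hx.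
have : nbhs (h x) [set r : R | r != 0].
  by apply: open_nbhs_nbhs; split => //; exact: open_neq.
by move/ch.
Qed.

Lemma smooth_atV V (h : V -> R) x :
  smooth_at h x -> h x != 0 -> smooth_at (fun y => (h y)^-1) x.
Proof.
move=> sh hx.
have := near_neq0 (smooth_at_diff sh) hx.
rewrite -nbhs_nearE nbhsE => -[U1 [oU1 U1x] hU1].
case/smooth_atP: sh => U [oU Ux hU].
have oU2 : open (U `&` U1) by exact: openI.
apply/smooth_atP; exists (U `&` U1); split=> // k.
have {}hU j : Ck_on (U `&` U1) j h by move=> vs sz y [Uy _]; exact: (hU j).
elim: k => [|k IH].
  by apply: Ck_on0 => y Uy; apply: differentiableV; [exact: Ck_on_diff (hU 0) Uy | exact/hU1/Uy.2].
apply/Ck_onS; split=> [y Uy|v].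
  by apply: differentiableV; [exact: Ck_on_diff (hU 0) Uy | exact/hU1/Uy.2].
apply: (@eq_Ck_on _ _ _ _ _ (fun y => (h y)^-1 *: ((h y)^-1 *: (-1 *: 'D_v h y)))) => // [y Uy|].
  rewrite deriveV; last 2 first.
  - exact/hU1/Uy.2.
  - exact: diff_derivable (Ck_on_diff (hU 0) Uy).
  by rewrite scaleN1r !scalerN scaleNr scalerA expr2 invfM.
apply: Ck_on_scale => //; apply: Ck_on_scale => //; apply: Ck_on_scale => //.
  exact: Ck_on_cst.
by have /Ck_onS[] := hU k.+1.
Qed.

Lemma smooth_at_det V n (A : V -> 'M[R]_n) x :
  (forall i j, smooth_at (fun y => A y i j) x) -> smooth_at (fun y => \det (A y)) x.
Proof.
move=> sA; apply: smooth_at_sum => s; apply: smooth_atM; first exact: smooth_at_cst.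
exact: smooth_at_prod.
Qed.

Lemma smooth_at_mulmx V p q l (A : V -> 'M[R]_(p, q)) (B : V -> 'M[R]_(q, l)) x i j :
  (forall i j, smooth_at (fun y => A y i j) x) ->
  (forall i j, smooth_at (fun y => B y i j) x) ->
  smooth_at (fun y => (A y *m B y) i j) x.
Proof.
move=> sA sB; under eq_fun do rewrite mxE.
by apply: smooth_at_sum => a; exact: smooth_atM.
Qed.

Lemma smooth_at_adj V n (A : V -> 'M[R]_n) x i j :
  (forall i j, smooth_at (fun y => A y i j) x) -> smooth_at (fun y => \adj (A y) i j) x.
Proof.
move=> sA; under eq_fun do rewrite mxE /cofactor.
apply: smooth_atM; first exact: smooth_at_cst.
by apply: smooth_at_det => i' j'; under eq_fun do rewrite !mxE; exact: sA.
Qed.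

(** Let [K] be a right inverse of the value of [A] at [x].  The determinant of the
    square matrix [A y *m K] does not vanish near [x], so Cramer's rule
    writes [f] near [x] as a smooth expression in [f y *m A y]. *)
Lemma smooth_at_solution V p q (A : V -> 'M[R]_(p, q)) (f : V -> 'rV[R]_p) x :
  (forall i j, smooth_at (fun y => A y i j) x) -> row_free (A x) ->
  smooth_at (fun y => f y *m A y) x -> smooth_at f x.
Proof.
move=> sA /row_freeP[K AK] sfA.
pose G y := A y *m K.
have sG i j : smooth_at (fun y => G y i j) x.
  by apply: smooth_at_mulmx => // i' j'; exact: smooth_at_cst.
have sd := smooth_at_det sG.
have dx : \det (G x) != 0 by rewrite /G AK det1 oner_neq0.
have nd := near_neq0 (smooth_at_diff sd) dx.
apply: (@near_smooth_at _ _ _ (fun y => (\det (G y))^-1 *: (f y *m A y *m (K *m \adj (G y))))).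
  apply: filterS nd => y dy; rewrite !mulmxA -(mulmxA (f y)) -/(G y) -mulmxA mul_mx_adj.
  by rewrite mul_mx_scalar scalerA mulVf // scale1r.
apply: smooth_at_scale; first exact: smooth_atV.
apply: smooth_at_row => j; apply: smooth_at_mulmx => i j'.
  by rewrite ord1; exact: smooth_at_coord.
apply: smooth_at_mulmx => i' l; first exact: smooth_at_cst.
exact: smooth_at_adj.
Qed.

Lemma smooth_at_derive_comm V n (f : V -> 'rV[R]_n) x u v :
  smooth_at f x -> 'D_v ('D_u f) x = 'D_u ('D_v f) x.
Proof.
move=> sf; apply/rowP => i.
have E w w' : ('D_w' ('D_w f) x) 0 i = 'D_w' ('D_w (fun y => f y 0 i)) x.
  rewrite -(diff_coord i (smooth_at_diff (smooth_at_derive w sf))).2.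
  apply: near_eq_derive; apply: filterS (smooth_at_near sf) => y sy.
  by rewrite (diff_coord i (smooth_at_diff sy)).2.
have si := smooth_at_coord i sf.
apply: (etrans (E u v)); apply: (etrans _ (esym (E v u))).
apply: derive_comm; last 2 first.
- exact: smooth_at_diff (smooth_at_derive u si).
- exact: smooth_at_diff (smooth_at_derive v si).
by apply: filterS (smooth_at_near si) => y; exact: smooth_at_diff.
Qed.

Lemma derive_dir_sum p W (f : 'rV[R]_p -> W) x (v : 'rV[R]_p) :
  differentiable f x -> 'D_v f x = \sum_i v 0 i *: 'D_(delta_mx 0 i) f x.
Proof.
move=> df; rewrite deriveE // [X in _ X = _]row_sum_delta linear_sum /=.
by apply: eq_bigr => i _; rewrite linearZ (deriveE _ df).
Qed.

Lemma smooth_at_dir p W (f : 'rV[R]_p -> W) (v : 'rV[R]_p -> 'rV[R]_p) x :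
  smooth_at f x -> smooth_at v x -> smooth_at (fun z => 'D_(v z) f z) x.
Proof.
move=> sf sv.
apply: (@near_smooth_at _ _ _ (fun z => \sum_i v z 0 i *: 'D_(delta_mx 0 i) f z)).
  by apply: filterS (smooth_at_near sf) => z /smooth_at_diff df; apply: esym; exact: derive_dir_sum.
apply: smooth_at_sum => i; apply: smooth_at_scale; first exact: smooth_at_coord.
exact: smooth_at_derive.
Qed.

Lemma derive_sum_scale V p W (h : V -> 'rV[R]_p) (g : 'I_p -> V -> W) x a :
  differentiable h x -> (forall i, differentiable (g i) x) ->
  'D_a (fun z => \sum_i h z 0 i *: g i z) x =
  \sum_i ('D_a h x) 0 i *: g i x + \sum_i h x 0 i *: 'D_a (g i) x.
Proof.
move=> dh dg.
have H i := diff_scale (diff_coord i dh).1 (dg i).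
rewrite (_ : (fun z => _) = \sum_i (fun z => h z 0 i *: g i z)); last first.
  by apply/funext => z; rewrite fct_sumE.
rewrite derive_sum => [|i]; last by apply: diff_derivable; case: (H i).
rewrite -big_split; apply: eq_bigr => i _ /=.
by rewrite (H i).2 (diff_coord i dh).2 addrC.
Qed.

(** In coordinates the commutator of two derivations is again a derivation: the
    terms that involve second derivatives of [f] cancel by symmetry. *)
Lemma derive_commutator p n (f : 'rV[R]_p -> 'rV[R]_n) (u v : 'rV[R]_p -> 'rV[R]_p) x :
  smooth_at f x -> differentiable u x -> differentiable v x ->
  'D_(u x) (fun z => 'D_(v z) f z) x - 'D_(v x) (fun z => 'D_(u z) f z) x =
  'D_('D_(u x) v x - 'D_(v x) u x) f x.
Proof.
move=> sf du dv.
have E a (w : 'rV[R]_p -> 'rV[R]_p) : differentiable w x ->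
    'D_a (fun z => 'D_(w z) f z) x = 'D_('D_a w x) f x + 'D_(w x) ('D_a f) x.
  move=> dw; have df := smooth_at_diff sf.
  have da := smooth_at_diff (smooth_at_derive a sf).
  apply: (@etrans _ _ ('D_a (fun z => \sum_i w z 0 i *: 'D_(delta_mx 0 i) f z) x)).
    apply: near_eq_derive; apply: filterS (smooth_at_near sf) => z /smooth_at_diff.
    exact: derive_dir_sum.
  apply: (etrans (derive_sum_scale a dw _)) => [i|].
    exact: smooth_at_diff (smooth_at_derive _ sf).
  apply: (congr2 +%R (esym (derive_dir_sum _ df))).
  apply: (etrans _ (esym (derive_dir_sum _ da))).
  apply: eq_bigr => i _; apply: (congr1 ( *:%R (w x 0 i))).
  exact: smooth_at_derive_comm.
have S := smooth_at_derive_comm (u x) (v x) sf.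
apply: (etrans (congr2 (fun a b => a - b)
  (etrans (E (u x) v dv) (congr1 (fun t => _ + t) S)) (E (v x) u du))).
have addKr (a b c : 'rV[R]_n) : a + c - (b + c) = a - b.
  by rewrite opprD addrACA subrr addr0.
apply: (etrans (addKr _ _ _)).
have df := smooth_at_diff sf.
apply: (etrans (congr2 (fun a b => a - b) (deriveE _ df) (deriveE _ df))).
by apply: esym; apply: (etrans (deriveE _ df)); exact: linearB.
Qed.

End SmoothFunctions.

(** * Derivatives of functions on a manifold *)

Section ManifoldFunctions.
Context {R : realType} {n : nat} {M : manifold R n}.
Implicit Types (W : normedModType R) (x : M).

Lemma near_msmooth_at W (f g : M -> W) x :
  (\forall y \near x, f y = g y) -> msmooth_at f x -> msmooth_at g x.
Proof. by move=> fg sf c ac cx; exact: near_smooth_at (near_cbwd cx fg) (sf c ac cx). Qed.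

Lemma msmooth_at_scale W (h : M -> R) (f : M -> W) x :
  msmooth_at h x -> msmooth_at f x -> msmooth_at (fun y => h y *: f y) x.
Proof.
move=> sh sf c ac cx.
exact: smooth_at_scale (sh c ac cx) (sf c ac cx).
Qed.

Lemma msmooth_at_sum W (J : Type) (s : seq J) (F : J -> M -> W) x :
  (forall i, msmooth_at (F i) x) -> msmooth_at (fun y => \sum_(i <- s) F i y) x.
Proof.
move=> sF c ac cx.
by apply: (@smooth_at_sum _ _ _ _ _ (fun i => F i \o cbwd c)) => i; exact: sF.
Qed.

Lemma msmooth_at_coord k (f : M -> 'rV[R]_k) (i : 'I_k) x :
  msmooth_at f x -> msmooth_at (fun y => f y 0 i) x.
Proof.
move=> sf c ac cx.
exact: smooth_at_coord (sf c ac cx).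
Qed.

Lemma msmooth_at_chart (c : chart R M n) x :
  atlas c -> cdom c x -> msmooth_at (cfwd c) x.
Proof. by move=> ac cx d ad dx; exact: atlas_compatible. Qed.

Lemma msmooth_at_diff W (f : M -> W) x : msmooth_at f x ->
  differentiable (f \o cbwd (chart_at x)) (cfwd (chart_at x) x).
Proof.
by move=> sf; apply/smooth_at_diff/sf; [exact: atlas_chart_at | exact: chart_at_dom].
Qed.

Lemma tangent_coord_id x (v : TM M x) :
  tcoord (tangent_triv (atlas_chart_at x)) x v = v.
Proof. exact: transition_diff_id (chart_at_dom x). Qed.

(** [dfun] is defined through the chart selected at each point; near a fixed point
    it has to be computed in one and the same chart. *)
Lemma dfun_chart W (f : M -> W) (c : chart R M n) (ac : atlas c) x (v : TM M x) :
  cdom c x -> differentiable (f \o cbwd c) (cfwd c x) ->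
  dfun f x v = 'D_(tcoord (tangent_triv ac) x v) (f \o cbwd c) (cfwd c x).
Proof.
move=> cx df; rewrite deriveE //.
have ad := atlas_chart_at x; have dx := chart_at_dom x.
rewrite /dfun /=; set d := chart_at x in ad dx *.
have E : \forall z \near cfwd d x,
    ((f \o cbwd c) \o (cfwd c \o cbwd d)) z = (f \o cbwd d) z.
  apply: filterS (near_cbwd dx (near_open (open_cdom c) cx)) => z cz /=.
  by rewrite cfwdK.
have ddc := smooth_at_diff (atlas_compatible ad ac dx cx).
have Ex : (cfwd c \o cbwd d) (cfwd d x) = cfwd c x by rewrite /= cfwdK.
have dc : differentiable (f \o cbwd c) ((cfwd c \o cbwd d) (cfwd d x)) by rewrite Ex.
have D1 := congr1 (fun D => D v) (near_diff E (differentiable_comp ddc dc)).2.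
have D2 := congr1 (fun D => D v) (diff_comp ddc dc).
apply: (etrans D1); apply: (etrans D2).
rewrite /transition_diff -[in RHS]Ex; exact: erefl.
Qed.

Lemma near_dfun_chart W (f : M -> W) (V : section (TM M)) (c : chart R M n)
    (ac : atlas c) x :
  cdom c x -> msmooth_at f x ->
  \forall z \near cfwd c x,
    'D_(tcoord (tangent_triv ac) (cbwd c z) (V (cbwd c z))) (f \o cbwd c) z =
    dfun f (cbwd c z) (V (cbwd c z)).
Proof.
move=> cx sf.
apply: filterS2 (near_cdom cx) (smooth_at_near (sf c ac cx)) => z [cz Ez] fz.
by rewrite (dfun_chart ac) // Ez //; exact: smooth_at_diff.
Qed.

Lemma msmooth_at_dfun k (f : M -> 'rV[R]_k) (V : section (TM M)) x :
  msmooth_at f x -> smooth_sec V x -> msmooth_at (fun y => dfun f y (V y)) x.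
Proof.
move=> sf sV c ac cx.
apply: near_smooth_at (near_dfun_chart V ac cx sf) _.
have sv := sV (tangent_triv ac) (ex_intro _ c (ex_intro _ ac erefl)) cx c ac cx.
apply: smooth_at_dir sv; exact: sf.
Qed.

End ManifoldFunctions.

Section Bracket.
Context {R : realType} {n : nat} {M : manifold R n}.

Lemma msmooth_at_tangent (V : section (TM M)) (c : chart R M n) (ac : atlas c) x :
  cdom c x -> smooth_sec V x -> msmooth_at (fun y => tcoord (tangent_triv ac) y (V y)) x.
Proof. by move=> cx; apply => //; exists c, ac. Qed.

Lemma dfunE (W : normedModType R) (f : M -> W) x (v : TM M x) : msmooth_at f x ->
  dfun f x v = 'D_v (f \o cbwd (chart_at x)) (cfwd (chart_at x) x).
Proof. by move=> sf; apply: esym; apply: deriveE; exact: msmooth_at_diff. Qed.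

(** The bracket acts on functions as the commutator of derivations. *)
Lemma dfun_bracket k (f : M -> 'rV[R]_k) (U V : section (TM M)) x :
  msmooth_at f x -> smooth_sec U x -> smooth_sec V x ->
  dfun f x (bracket U V x) =
  dfun (fun y => dfun f y (V y)) x (U x) - dfun (fun y => dfun f y (U y)) x (V x).
Proof.
move=> sf sU sV.
have ac := atlas_chart_at x; have cx := chart_at_dom x.
pose c := chart_at x; pose t := tangent_triv (atlas_chart_at x).
pose z0 := cfwd c x.
pose fld (X : section (TM M)) z : 'rV[R]_n := tcoord t (cbwd c z) (X (cbwd c z)).
have fld0 X : fld X z0 = X x.
  by rewrite /fld cfwdK //; exact: tangent_coord_id.
have sfld X : smooth_sec X x -> smooth_at (fld X) z0.
  by move=> sX; exact: (msmooth_at_tangent (atlas_chart_at x) cx sX).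
have Ef X Y : smooth_sec X x -> smooth_sec Y x ->
    dfun (fun y => dfun f y (Y y)) x (X x) =
    'D_(fld X z0) (fun z => 'D_(fld Y z) (f \o cbwd c) z) z0.
  move=> sX sY; rewrite fld0; apply: (etrans (dfunE _ (msmooth_at_dfun sf sY))).
  apply: near_eq_derive; apply: filterS (near_dfun_chart Y (atlas_chart_at x) cx sf) => z Ez.
  exact: esym Ez.
have Eb X Y : smooth_sec X x -> smooth_sec Y x ->
    dfun (fun y => dfun (cfwd c) y (Y y)) x (X x) = 'D_(fld X z0) (fld Y) z0.
  move=> sX sY; rewrite fld0.
  exact: (dfunE _ (msmooth_at_tangent (atlas_chart_at x) cx sY)).
apply: (etrans (dfunE _ sf)); apply: esym.
apply: (etrans (congr2 (fun a b => a - b) (Ef U V sU sV) (Ef V U sV sU))).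
apply: (etrans (derive_commutator (sf _ ac cx) (smooth_at_diff (sfld U sU))
                                  (smooth_at_diff (sfld V sV)))).
by apply: (congr1 (fun w => 'D_w (f \o cbwd c) z0)); rewrite -(Eb U V) // -(Eb V U).
Qed.

Lemma dfun_sum_scale p k (h : M -> 'rV[R]_p) (g : 'I_p -> M -> 'rV[R]_k) x (v : TM M x) :
  msmooth_at h x -> (forall i, msmooth_at (g i) x) ->
  dfun (fun y => \sum_i h y 0 i *: g i y) x v =
  \sum_i (dfun h x v) 0 i *: g i x + \sum_i h x 0 i *: dfun (g i) x v.
Proof.
move=> sh sg.
have shg : msmooth_at (fun y => \sum_i h y 0 i *: g i y) x.
  by apply: msmooth_at_sum => i; apply: msmooth_at_scale => //; exact: msmooth_at_coord.
apply: (etrans (dfunE v shg)).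
apply: (etrans (derive_sum_scale v (msmooth_at_diff sh) (fun i => msmooth_at_diff (sg i)))).
have cx := cfwdK (chart_at_dom x).
congr (_ + _); apply: eq_bigr => i _.
  by rewrite (dfunE v sh) /= cx.
apply: (congr2 *:%R); first by rewrite /= cx.
exact: esym (dfunE v (sg i)).
Qed.

Lemma near_eq_dfun (W : normedModType R) (f g : M -> W) x (v : TM M x) :
  (\forall y \near x, f y = g y) -> msmooth_at f x -> dfun f x v = dfun g x v.
Proof.
move=> fg sf; have E := near_cbwd (chart_at_dom x) fg.
exact: esym (congr1 (fun D => D v) (near_diff E (msmooth_at_diff sf)).2).
Qed.

End Bracket.

Section MapDifferential.
Context {R : realType} {n k : nat} {P : manifold R k} {B : manifold R n}.
Variable phi : smooth_map P B.

Lemma near_smap (A : set B) p : (\forall b \near phi p, A b) -> \forall q \near p, A (phi q).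
Proof. by move=> Ap; exact: (smap_continuous (x := p) Ap). Qed.

Lemma dfun_comp (W : normedModType R) (f : B -> W) p (v : TM P p) :
  msmooth_at f (phi p) -> dfun (f \o phi) p v = dfun f (phi p) (tmap phi p v).
Proof.
move=> sf.
have ap := atlas_chart_at p; have dp := chart_at_dom p.
have ab := atlas_chart_at (phi p); have db := chart_at_dom (phi p).
rewrite /dfun /tmap; set c := chart_at p in ap dp *; set d := chart_at (phi p) in ab db *.
have E : \forall z \near cfwd c p,
    ((f \o cbwd d) \o (cfwd d \o phi \o cbwd c)) z = ((f \o phi) \o cbwd c) z.
  have := near_cbwd dp (near_smap (near_open (open_cdom d) db)).
  by apply: filterS => z dz /=; rewrite cfwdK.
have dphi := smooth_at_diff (smap_smooth ap dp ab db).
have Ex : (cfwd d \o phi \o cbwd c) (cfwd c p) = cfwd d (phi p) by rewrite /= cfwdK.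
have df : differentiable (f \o cbwd d) ((cfwd d \o phi \o cbwd c) (cfwd c p)).
  by rewrite Ex; exact: msmooth_at_diff.
have D1 := congr1 (fun D => D v) (near_diff E (differentiable_comp dphi df)).2.
have D2 := congr1 (fun D => D v) (diff_comp dphi df).
apply: (etrans D1); apply: (etrans D2); rewrite -[in RHS]Ex; exact: erefl.
Qed.

Lemma tangent_tmap (c : chart R B n) (ac : atlas c) p (v : TM P p) : cdom c (phi p) ->
  tcoord (tangent_triv ac) (phi p) (tmap phi p v) = dfun (cfwd c \o phi) p v.
Proof. by move=> cp; apply: esym; apply: dfun_comp; exact: msmooth_at_chart. Qed.

Lemma tmap_smooth p (V : section (TM P)) : smooth_sec V p ->
  smooth_sec (fun q => tmap phi q (V q) : pullback phi (TM B) q) p.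
Proof.
move=> sV _ [_ [c [ac ->]] <-] cp /=.
apply: (@near_msmooth_at _ _ _ _ (fun q => dfun (cfwd c \o phi) q (V q))).
  apply: filterS (near_smap (near_open (open_cdom c) cp)) => q cq.
  by apply: esym; exact: tangent_tmap.
by apply: msmooth_at_dfun sV; apply: msmooth_at_comp; exact: msmooth_at_chart.
Qed.

Definition tmap_hom : bundle_hom (TM P) (pullback phi (TM B)) :=
  @BundleHom R k P k n (TM P) (pullback phi (TM B)) (fun p => tmap phi p) tmap_smooth.

(** The bracket is natural for fields that need not be projectable: the components
    of [tmap phi _ (X _)] are the derivatives along [X] of the coordinates of
    [phi], to which the commutator formula applies. *)
Lemma tmap_bracket (U V : section (TM P)) p : smooth_sec U p -> smooth_sec V p ->
  let t := tangent_triv (atlas_chart_at (phi p)) in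
  tmap phi p (bracket U V p) =
  dfun (fun q => tcoord t (phi q) (tmap phi q (V q))) p (U p)
  - dfun (fun q => tcoord t (phi q) (tmap phi q (U q))) p (V p).
Proof.
move=> sU sV t.
have ac := atlas_chart_at (phi p); have cp := chart_at_dom (phi p).
set c := chart_at (phi p) in ac cp.
have sf : msmooth_at (cfwd c \o phi) p.
  by apply: msmooth_at_comp; exact: msmooth_at_chart.
have E X v : smooth_sec X p -> dfun (fun q => tcoord t (phi q) (tmap phi q (X q))) p v =
    dfun (fun q => dfun (cfwd c \o phi) q (X q)) p v.
  move=> sX; apply: esym; apply: near_eq_dfun; last exact: msmooth_at_dfun.
  apply: filterS (near_smap (near_open (open_cdom c) cp)) => q cq.
  by apply: esym; exact: tangent_tmap.
apply: (etrans (esym (tangent_coord_id (tmap phi p (bracket U V p))))).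
apply: (etrans (tangent_tmap ac _ cp)); apply: (etrans (dfun_bracket sf sU sV)).
by apply: (congr2 (fun a b => a - b)); apply: esym; exact: E.
Qed.

End MapDifferential.

(** * Sections of vector bundles *)

Section Frames.
Context {R : realType} {n r : nat} {M : manifold R n} {E : vbundle M r}.

Definition frame (t : local_triv E r) (i : 'I_r) : section E :=
  fun x => tframe t x (delta_mx 0 i).

Lemma frame_smooth (t : local_triv E r) i x : trivs t -> tdom t x ->
  smooth_sec (frame t i) x.
Proof. by move=> Et tx s Es sx; exact: trivs_compatible. Qed.

Lemma frame_sum (t : local_triv E r) x (e : E x) : tdom t x ->
  e = \sum_i (tcoord t x e) 0 i *: frame t i x.
Proof.
move=> tx; apply: (can_inj (tcoordK tx)); rewrite linear_sum [LHS]row_sum_delta.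
by apply: eq_bigr => i _; rewrite linearZ /= tframeK.
Qed.

End Frames.

Section PullbackHom.
Context {R : realType} {n k r l : nat} {P : manifold R k} {B : manifold R n}.
Context (phi : smooth_map P B) {E : vbundle B r} {E' : vbundle B l} (L : bundle_hom E E').

Lemma pullback_hom_expand (t : local_triv E r) (t' : local_triv E' l) p
    (s : section (pullback phi E)) : tdom t (phi p) ->
  tcoord t' (phi p) (L (phi p) (s p)) =
  \sum_i (tcoord t (phi p) (s p)) 0 i *:
    tcoord t' (phi p) (L (phi p) (frame t i (phi p))).
Proof.
move=> tp; rewrite {1}[s p](frame_sum _ tp) !linear_sum.
by apply: eq_bigr => i _; rewrite !linearZ.
Qed.

Lemma pullback_hom_coef_smooth (t : local_triv E r) (t' : local_triv E' l) b i :
  trivs t -> tdom t b -> trivs t' -> tdom t' b ->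
  msmooth_at (fun y => tcoord t' y (L y (frame t i y))) b.
Proof. by move=> Et tb Et' tb'; apply: happ_smooth => //; exact: frame_smooth. Qed.

(** A section along [phi] is not the pull-back of a section of [E], so [happ_smooth]
    is applied to a frame and the coordinates are carried along. *)
Lemma pullback_hom_smooth p (s : section (pullback phi E)) : smooth_sec s p ->
  smooth_sec (fun q => L (phi q) (s q) : pullback phi E' q) p.
Proof.
move=> ss _ [t' Et' <-] t'p.
have [t Et tp] := trivs_cover E (phi p).
apply: near_msmooth_at (_ : msmooth_at (fun q => \sum_i (tcoord t (phi q) (s q)) 0 i *:
    tcoord t' (phi q) (L (phi q) (frame t i (phi q)))) p).
  apply: filterS (near_smap (near_open (open_tdom t) tp)) => q tq.
  by apply: esym; exact: pullback_hom_expand.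
apply: msmooth_at_sum => i; apply: msmooth_at_scale.
  apply: msmooth_at_coord; apply: (ss (pullback_triv phi t)) => //; by exists t.
exact: (msmooth_at_comp (pullback_hom_coef_smooth i Et tp Et' t'p)).
Qed.

End PullbackHom.

(** In local frames [s] solves a linear system with smooth coefficients and smooth
    right-hand side.  A horizontal lift is of this form, with [theta] and the
    differential of the projection as the two maps. *)
Lemma smooth_sec_of_images (R : realType) n r r1 r2 (M : manifold R n) (E : vbundle M r)
    (E1 : vbundle M r1) (E2 : vbundle M r2) (L1 : bundle_hom E E1) (L2 : bundle_hom E E2)
    (s : section E) x :
  (forall v, L1 x v = 0 -> L2 x v = 0 -> v = 0) ->
  smooth_sec (fun y => L1 y (s y)) x -> smooth_sec (fun y => L2 y (s y)) x ->
  smooth_sec s x.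
Proof.
move=> inj s1 s2 t Et tx c ac cx.
have [t1 Et1 tx1] := trivs_cover E1 x.
have [t2 Et2 tx2] := trivs_cover E2 x.
pose A y : 'M[R]_(r, r1 + r2) := \matrix_i
  row_mx (tcoord t1 y (L1 y (frame t i y))) (tcoord t2 y (L2 y (frame t i y))).
have uA y (u : 'rV[R]_r) : tdom t y -> u *m A y =
    row_mx (tcoord t1 y (L1 y (tframe t y u))) (tcoord t2 y (L2 y (tframe t y u))).
  move=> ty; rewrite [tframe t y u](frame_sum _ ty) tframeK // mulmx_sum_row !linear_sum.
  under eq_bigr do rewrite rowK.
  apply/rowP => j; rewrite summxE; case: (split_ordP j) => j' ->.
    by rewrite row_mxEl summxE; apply: eq_bigr => i _; rewrite mxE row_mxEl !linearZ mxE.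
  by rewrite row_mxEr summxE; apply: eq_bigr => i _; rewrite mxE row_mxEr !linearZ mxE.
have s12 (w1 : section E1) (w2 : section E2) : smooth_sec w1 x -> smooth_sec w2 x ->
    msmooth_at (fun y => row_mx (tcoord t1 y (w1 y)) (tcoord t2 y (w2 y))) x.
  move=> sw1 sw2 d ad dx; apply: smooth_at_row => j; case: (split_ordP j) => j' -> /=.
    by under eq_fun do rewrite row_mxEl; exact: (smooth_at_coord j' (sw1 t1 Et1 tx1 d ad dx)).
  by under eq_fun do rewrite row_mxEr; exact: (smooth_at_coord j' (sw2 t2 Et2 tx2 d ad dx)).
apply: (@smooth_at_solution R _ _ _ (A \o cbwd c)
  ((fun y => tcoord t y (s y)) \o cbwd c)) => [i j||].
- under eq_fun do rewrite /= mxE.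
  have sF := frame_smooth i Et tx.
  exact: (smooth_at_coord j (s12 _ _ (happ_smooth L1 sF) (happ_smooth L2 sF) c ac cx)).
- rewrite /= cfwdK //; apply: inj_row_free => u.
  rewrite uA // -row_mx0 => /eq_row_mx[e1 e2].
  rewrite -(tframeK tx u) (_ : tframe t x u = 0) ?linear0 //.
  apply: inj; first by apply: (can_inj (tcoordK tx1)); rewrite e1 linear0.
  by apply: (can_inj (tcoordK tx2)); rewrite e2 linear0.
apply: near_smooth_at (s12 _ _ s1 s2 c ac cx).
apply: filterS (near_cbwd cx (near_open (open_tdom t) tx)) => z tz.
by rewrite /= uA // tcoordK.
Qed.

(** * The Nijenhuis tensor along a map *)

Section Nijenhuis.
Context {R : realType} {n : nat} {B : manifold R n}.

Local Notation ctriv b := (tangent_triv (atlas_chart_at b) : local_triv (TM B) n).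

Lemma trivs_ctriv (b : B) : @trivs _ _ _ _ (TM B) (ctriv b).
Proof. by exists (chart_at b), (atlas_chart_at b). Qed.

(** The derivative along [a] of the matrix of [L] in the chart at [b], applied to
    [v]; it depends on that chart. *)
Definition hom_derivative (L : bundle_hom (TM B) (TM B)) (b : B) (a v : TM B b) : TM B b :=
  \sum_i (tcoord (ctriv b) b v) 0 i *:
    dfun (fun y => tcoord (ctriv b) y (L y (frame (ctriv b) i y))) b a.

Section Along.
Context {k : nat} {P : manifold R k} (phi : smooth_map P B).

(** The Leibniz rule for [L] applied to a field along [phi]. *)
Lemma dfun_hom (L : bundle_hom (TM B) (TM B)) p (W : section (pullback phi (TM B)))
    (a : TM P p) : smooth_sec W p ->
  dfun (fun q => tcoord (ctriv (phi p)) (phi q) (L (phi q) (W q))) p a =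
  L (phi p) (dfun (fun q => tcoord (ctriv (phi p)) (phi q) (W q)) p a) +
  hom_derivative L (tmap phi p a) (W p).
Proof.
move=> sW; set t := ctriv (phi p).
have Et := trivs_ctriv (phi p); have tp : tdom t (phi p) := chart_at_dom (phi p).
pose g i y := tcoord t y (L y (frame t i y)).
have sg i : msmooth_at (g i) (phi p) by exact: pullback_hom_coef_smooth.
have sw : msmooth_at (fun q => tcoord t (phi q) (W q)) p.
  by apply: (sW (pullback_triv phi t)) => //; exists t.
have sgp i : msmooth_at (g i \o phi) p by exact: msmooth_at_comp.
apply: (@etrans _ _ (dfun (fun q => \sum_i (tcoord t (phi q) (W q)) 0 i *: (g i \o phi) q) p a)).
  apply: esym; apply: near_eq_dfun.
    apply: filterS (near_smap (near_open (open_tdom t) tp)) => q tq.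
    by apply: esym; exact: pullback_hom_expand.
  by apply: msmooth_at_sum => i; apply: msmooth_at_scale => //; exact: msmooth_at_coord.
apply: (etrans (dfun_sum_scale a sw sgp)); apply: (congr2 +%R).
  set d : TM B (phi p) := dfun _ p a.
  rewrite [in RHS](frame_sum d tp) linear_sum.
  apply: eq_bigr => i _; rewrite linearZ /=; congr (_ *: _).
    by congr (fun_of_matrix _ _ _); exact: esym (tangent_coord_id d).
  exact: tangent_coord_id.
apply: eq_bigr => i _; apply: (congr1 ( *:%R _)); exact: dfun_comp.
Qed.

End Along.

(** Here [a, b, c, d] stand for the derivatives of the coordinates of the two fields
    and [e, f, g, h] for the derivatives of [J]: the former drop out. *)
Lemma nijenhuis_cancel (Z : zmodType) (J : {additive Z -> Z}) (a b c d e f g h : Z) :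
  (forall z, J (J z) = - z) ->
  (J a + e - (J b + f)) - J (a - (J c + g)) - J (J d + h - b) - (d - c)
  = e - f + J g - J h.
Proof.
move=> JJ; rewrite !(raddfB, raddfD) /= !JJ.
rewrite !opprK [LHS](AC ((((2*2)*(1*2))*3)*2)
  (((1*5)*(3*10)*(6*12)*(8*11))*(2*4*7*9)))%AC.
by rewrite /= !subrr !addNr !add0r.
Qed.

Variable I : almost_complex B.

(** The coordinate formula of the Nijenhuis tensor: it involves [u] and [v] only
    through their values at [b]. *)
Definition nijenhuis_jet (b : B) (u v : TM B b) : TM B b :=
  hom_derivative I (I b u) v - hom_derivative I (I b v) u
  + I b (hom_derivative I v u) - I b (hom_derivative I u v).

(** The fields live on [P] and need not be projectable, so the same fields can be
    used for several maps [phi]. *)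
Lemma nijenhuis_jet_along k (P : manifold R k) (phi : smooth_map P B) p
    (U V U' V' : section (TM P)) :
  smooth_sec U p -> smooth_sec V p -> smooth_sec U' p -> smooth_sec V' p ->
  (forall q, tmap phi q (U' q) = I (phi q) (tmap phi q (U q))) ->
  (forall q, tmap phi q (V' q) = I (phi q) (tmap phi q (V q))) ->
  tmap phi p (bracket U' V' p) - I (phi p) (tmap phi p (bracket U' V p))
    - I (phi p) (tmap phi p (bracket U V' p)) - tmap phi p (bracket U V p) =
  nijenhuis_jet (tmap phi p (U p)) (tmap phi p (V p)).
Proof.
move=> sU sV sU' sV' EU EV.
pose t := ctriv (phi p).
pose d (X : section (TM P)) (a : TM P p) : TM B (phi p) :=
  dfun (fun q => tcoord t (phi q) (tmap phi q (X q))) p a.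
have br X Y : smooth_sec X p -> smooth_sec Y p ->
  tmap phi p (bracket X Y p) = d Y (X p) - d X (Y p) by exact: tmap_bracket.
have dJ X X' a w : smooth_sec X p ->
    (forall q, tmap phi q (X' q) = I (phi q) (tmap phi q (X q))) -> tmap phi p a = w ->
    d X' a = I (phi p) (d X a) + hom_derivative I w (tmap phi p (X p)).
  move=> sX EX <-; have H := dfun_hom I a (tmap_smooth (phi := phi) sX).
  apply: (etrans _ H).
  by rewrite /d; congr (dfun _ p a); apply/funext => q; rewrite EX.
have E1 := etrans (br U' V' sU' sV')
  (congr2 (fun x y => x - y) (dJ V V' _ _ sV EV (EU p)) (dJ U U' _ _ sU EU (EV p))).
have E2 := etrans (br U' V sU' sV)
  (congr1 (fun y => d V (U' p) - y) (dJ U U' (V p) _ sU EU erefl)).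
have E3 := etrans (br U V' sU sV')
  (congr1 (fun y => y - d U (V' p)) (dJ V V' (U p) _ sV EV erefl)).
have E4 := br U V sU sV.
refine (etrans (congr2 _ (congr2 _ (congr2 _ E1 (congr1 _ (congr1 _ E2)))
  (congr1 _ (congr1 _ E3))) (congr1 _ E4)) _).
apply: nijenhuis_cancel; exact: acs_sqr.
Qed.

End Nijenhuis.

Section Identity.
Context {R : realType} {n : nat} (B : manifold R n).

Lemma id_smooth_map_smooth x (c d : chart R B n) : atlas c -> cdom c x -> atlas d ->
  cdom d x -> smooth_at (cfwd d \o id \o cbwd c) (cfwd c x).
Proof. by move=> ac cx ad dx; exact: atlas_compatible. Qed.

Definition id_map : smooth_map B B :=
  @SmoothMap R n n B B id (fun x => @cvg_id _ _) id_smooth_map_smooth.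

Lemma tmap_id x (v : TM B x) : tmap id_map x v = v.
Proof. exact: (transition_diff_id v (chart_at_dom x)). Qed.

(** [nijenhuis_jet_along] for the identity map, the extensions of [u] and [v] that
    define [nijenhuis], and their images under [I]. *)
Lemma nijenhuisE (I : almost_complex B) x (u v : TM B x) :
  nijenhuis I x u v = nijenhuis_jet I u v.
Proof.
pose U := projT1 (cid (section_through u)); pose V := projT1 (cid (section_through v)).
have [sU Ux] : smooth_sec U x /\ U x = u := projT2 (cid (section_through u)).
have [sV Vx] : smooth_sec V x /\ V x = v := projT2 (cid (section_through v)).
have sI X : smooth_sec X x -> smooth_sec (fun y => I y (X y)) x by exact: happ_smooth.
have E := nijenhuis_jet_along (I := I) (phi := id_map) sU sV (sI _ sU) (sI _ sV).
rewrite -[in RHS]Ux -[in RHS]Vx -[in RHS](tmap_id (U x)) -[in RHS](tmap_id (V x)).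
apply: esym; apply: (etrans (esym (E _ _))) => [q|q|].
- exact: (etrans (tmap_id _) (congr1 (I q) (esym (tmap_id (U q))))).
- exact: (etrans (tmap_id _) (congr1 (I q) (esym (tmap_id (V q))))).
exact: (congr2 (fun a b => a - b) (congr2 (fun a b => a - b) (congr2 (fun a b => a - b)
  (tmap_id _) (congr1 (I x) (tmap_id _))) (congr1 (I x) (tmap_id _))) (tmap_id _)).
Qed.

End Identity.

(** * Horizontal lifts *)

Section SectionAlgebra.
Context {R : realType} {n r : nat} {M : manifold R n} {E : vbundle M r}.

Lemma smooth_secB (s t : section E) x : smooth_sec s x -> smooth_sec t x ->
  smooth_sec (fun y => s y - t y) x.
Proof.
move=> ss st f Ef fx c ac cx.
rewrite (_ : _ \o _ = fun z =>
  tcoord f (cbwd c z) (s (cbwd c z)) + -1 *: tcoord f (cbwd c z) (t (cbwd c z))).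
  by apply: smooth_atD; [exact: ss|apply: smooth_at_scale; [exact: smooth_at_cst|exact: st]].
by apply/funext => z; rewrite /= scaleN1r linearB.
Qed.

Lemma nabla0 (D : connection E) x (v : TM M x) :
  smooth_sec (fun y : M => 0 : E y) x -> D x v (fun y => 0) = 0.
Proof.
move=> s0; have := nablaD D v s0 s0.
have -> : (fun y : M => 0 + 0 : E y) = (fun y => 0).
  by apply: functional_extensionality_dep => y; rewrite addr0.
by move=> /esym/eqP; rewrite -subr_eq0 addrK => /eqP.
Qed.

End SectionAlgebra.

Section HorizontalLifts.
Context {R : realType} {n r k : nat} {M : manifold R n} {E F : flat_bundle M r}
  {sd : shear_data E F} {P : manifold R k} (T : total_space sd P).

(** The differential of [phi] maps each horizontal space [ker theta] bijectively
    onto the tangent space of the base, so that [hlift] is the inverse and never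
    takes its default value. *)
Definition transverse m (B : manifold R m) (phi : smooth_map P B) : Prop :=
  forall p, (forall w, exists h, theta T p h = 0 /\ tmap phi p h = w) /\
    (forall h, theta T p h = 0 -> tmap phi p h = 0 -> h = 0).

Section Transverse.
Context {m : nat} {B : manifold R m} {phi : smooth_map P B} (tphi : transverse phi).

Local Notation lift p w := (hlift T (phi := phi) (p := p) w).

Lemma theta_hlift p w : theta T p (lift p w) = 0.
Proof. by case: (xgetPex 0 ((tphi p).1 w)). Qed.

Lemma tmap_hlift p w : tmap phi p (lift p w) = w.
Proof. by case: (xgetPex 0 ((tphi p).1 w)). Qed.

Lemma hlift_unique p h w : theta T p h = 0 -> tmap phi p h = w ->
  lift p w = h.
Proof.
move=> h0 hw; apply: subr0_eq; apply: (tphi p).2.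
  by rewrite linearB /= h0 theta_hlift subr0.
by rewrite linearB /= hw tmap_hlift subrr.
Qed.

Lemma hliftD p v w : lift p (v + w) = lift p v + lift p w.
Proof.
by apply: hlift_unique; rewrite linearD /= ?theta_hlift ?addr0 // !tmap_hlift.
Qed.

Lemma hliftN p v : lift p (- v) = - lift p v.
Proof.
by apply: hlift_unique; rewrite linearN /= ?theta_hlift ?oppr0 // tmap_hlift.
Qed.

End Transverse.

(** Surjectivity: subtract from any preimage its component along [rho].  The
    linear map [(theta, dpi)] is then onto a space of dimension [r + n], which is
    the dimension of [P], so it is injective. *)
Lemma transverse_proj : transverse (proj T).
Proof.
move=> p; have [_ surj _] := proj_leaf T.
have lift w : exists h, theta T p h = 0 /\ tmap (proj T) p h = w.
  have [v vw] := surj p w; exists (v - rho T p (theta T p v)).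
  by rewrite !linearB /= theta_rho proj_rho subrr subr0.
split=> // h h0 hw.
have [t _ tp] := trivs_cover F (proj T p).
pose L1 : {linear 'rV[R]_k -> 'rV[R]_r} := tcoord t (proj T p) \o theta T p.
pose L2 : {linear 'rV[R]_k -> 'rV[R]_n} := tmap (proj T) p.
pose A := row_mx (lin1_mx L1) (lin1_mx L2).
have hA u : u *m A = row_mx (L1 u) (L2 u) by rewrite mul_mx_row !mul_rV_lin1.
have Afull : row_full A.
  rewrite -sub1mx; apply/row_subP => i; apply/submxP.
  rewrite -[row i 1%:M]hsubmxK; set a := lsubmx _; set b := rsubmx _.
  have [g [g0 gb]] := lift b.
  exists (g + rho T p (tframe t (proj T p) a)); rewrite hA /L1 /L2 /=.
  by rewrite !linearD /= g0 gb theta_rho proj_rho addr0 linear0 add0r tframeK.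
have Afree : row_free A.
  by move: Afull; rewrite /row_full /row_free => /eqP ->; rewrite (proj_dim T) addnC.
by apply: (row_free_inj Afree); rewrite mul0mx hA /L1 /L2 /= h0 hw linear0 row_mx0.
Qed.

Lemma theta_xi_ring p (e : E (proj T p)) :
  theta T p (xi_ring (T := T) (p := p) e) = amap sd (proj T p) e.
Proof. by rewrite /xi_ring linearD /= (theta_hlift transverse_proj) add0r theta_rho. Qed.

(** The kernel of the differential of [sproj] is the range of [xi_ring], which
    [theta] maps onto the fibre of [F] by the invertible [a]: so each tangent
    vector can be made horizontal along that kernel in exactly one way. *)
Lemma transverse_sproj m (S : manifold R m) (sh : shear T S) : transverse (sproj sh).
Proof.
move=> p; have [_ surj _] := sproj_leaf sh; split=> [w|h h0 /sproj_ker[e he]].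
  have [v vw] := surj p w.
  pose e := ainv sd (proj T p) (theta T p v).
  exists (v - xi_ring e); rewrite !linearB /= theta_xi_ring ainvK subrr vw.
  by rewrite (_ : tmap _ _ (xi_ring e) = 0) ?subr0 //; apply/sproj_ker; exists e.
have e0 : e = 0.
  have := theta_xi_ring e; rewrite -he h0 => /esym ae.
  by rewrite -[e](amapK sd) ae linear0.
rewrite he e0 /xi_ring !linear0 addr0; apply: (hlift_unique transverse_proj); exact: linear0.
Qed.

End HorizontalLifts.

(** * The Nijenhuis tensors of a shear *)

Section HorizontalFields.
Context {R : realType} {n r k m : nat} {M : manifold R n} {E F : flat_bundle M r}
  {sd : shear_data E F} {P : manifold R k} {T : total_space sd P}
  {S : manifold R m} (sh : shear T S).

Local Notation pi := (proj T).
Local Notation piS := (sproj sh).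
Local Notation lift u := (hlift T (phi := pi) u).

Definition horizontal_field (X : section (TM P)) : Prop := forall q, theta T q (X q) = 0.

(** [v - rho (theta v)] projects any field onto a horizontal one. *)
Lemma horizontal_through p (h : TM P p) : theta T p h = 0 ->
  exists X : section (TM P), [/\ horizontal_field X, smooth_sec X p & X p = h].
Proof.
move=> h0; have [s [ss sp]] := section_through h.
exists (fun q => s q - rho T q (theta T q (s q))); split=> [q||].
- by rewrite linearB /= theta_rho subrr.
- by apply: smooth_secB => //; do 2 apply: happ_smooth.
- by rewrite sp h0 linear0 subr0.
Qed.

(** The structure equation [d theta = pi^* omega], in which the derivatives of
    [theta X = 0] and [theta Y = 0] vanish. *)
Lemma theta_bracket p (X Y : section (TM P)) : smooth_sec X p -> smooth_sec Y p ->
  horizontal_field X -> horizontal_field Y ->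
  theta T p (bracket X Y p) = - omega sd (pi p) (tmap pi p (X p)) (tmap pi p (Y p)).
Proof.
move=> sX sY hX hY.
have th0 Z : horizontal_field Z -> (fun q => theta T q (Z q)) = (fun q => 0).
  by move=> hZ; apply: functional_extensionality_dep.
have s0 : smooth_sec (fun q : P => 0 : pullback pi F q) p.
  by rewrite -(th0 X hX); exact: happ_smooth.
have := dtheta T sX sY; rewrite /dnabla1 !th0 // !nabla0 // subrr sub0r => <-.
by rewrite opprK.
Qed.

(** The isomorphism from the tangent space of [M] to that of [S] given by H. *)
Definition descend p (u : TM M (pi p)) : TM S (piS p) := tmap piS p (lift u).

Lemma descendD p (u v : TM M (pi p)) : descend (u + v) = descend u + descend v.
Proof. by rewrite /descend (hliftD (transverse_proj T)) linearD. Qed.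

Lemma descendN p (u : TM M (pi p)) : descend (- u) = - descend u.
Proof. by rewrite /descend (hliftN (transverse_proj T)) linearN. Qed.

(** The projection to [S] kills [xi_ring e]; take [e] to be the image of [f] under
    the inverse of [a]. *)
Lemma descend_rho p (f : F (pi p)) :
  tmap piS p (rho T p f) = - descend (xi sd (pi p) (ainv sd (pi p) f)).
Proof.
have : tmap piS p (xi_ring (T := T) (ainv sd (pi p) f)) = 0.
  by apply/sproj_ker; eexists.
rewrite /xi_ring linearD /= ainvK => /eqP; rewrite addrC addr_eq0 => /eqP ->.
by [].
Qed.

(** The vertical part of the bracket is [- rho omega], and the projection to [S]
    does not kill it but shears it: this is the origin of [xi_ainv_omega]. *)
Lemma tmap_sproj_bracket p (X Y : section (TM P)) : smooth_sec X p -> smooth_sec Y p ->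
  horizontal_field X -> horizontal_field Y ->
  tmap piS p (bracket X Y p) =
  descend (tmap pi p (bracket X Y p) +
           xi_ainv_omega sd (pi p) (tmap pi p (X p)) (tmap pi p (Y p))).
Proof.
move=> sX sY hX hY; have := theta_bracket sX sY hX hY.
set Z := bracket X Y p; set om := omega sd _ _ _ => tZ.
have hZ : lift (tmap pi p Z) = Z + rho T p om.
  apply: (hlift_unique (transverse_proj T)); rewrite linearD /=.
    by rewrite theta_rho tZ addNr.
  by rewrite proj_rho addr0.
have dZ : descend (tmap pi p Z) = tmap piS p Z + tmap piS p (rho T p om).
  by rewrite /descend hZ linearD.
by rewrite descendD dZ descend_rho addrNK.
Qed.

End HorizontalFields.

(** Here [b1, b2, b3, b4] stand for the projections to [M] of the four brackets and
    [f1, f2, f3, f4] for the corrections by which their projections to [S]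
    differ. *)
Lemma collect_curvature (Z : zmodType) (J : {additive Z -> Z}) (b1 b2 b3 b4 f1 f2 f3 f4 : Z) :
  b1 - J b2 - J b3 - b4 - f4 - J f2 - J f3 + f1 =
  b1 + f1 - J (b2 + f2) - J (b3 + f3) - (b4 + f4).
Proof.
by rewrite !raddfD [RHS](AC (((2*2)*2)*2) (1*3*5*7*8*4*6*2))%AC.
Qed.

Theorem proposition3p13 (R : realType) (n r k m : nat) (M : manifold R n)
    (E F : flat_bundle M r) (sd : shear_data E F)
    (P : manifold R k) (T : total_space sd P)
    (S : manifold R m) (sh : shear T S)
    (I : almost_complex M) (IS : almost_complex S)
    (hI : hrel_endo sh I IS) :
  let Phi := xi_ainv_omega sd in
  hrel_form sh
    (fun x v w =>
       nijenhuis I x v w - Phi x v w - I x (Phi x (I x v) w)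
         - I x (Phi x v (I x w)) + Phi x (I x v) (I x w))
    (nijenhuis IS).
Proof.
move=> Phi p v w.
have tM := transverse_proj T; have tS := transverse_sproj sh.
(* The almost complex structure carried to H, precomposed with the projection
   onto H along the kernel of the differential of proj T. *)
pose J (X : section (TM P)) : section (TM P) :=
  fun q => hlift T (phi := proj T) (I (proj T q) (tmap (proj T) q (X q))).
have hJ X : horizontal_field (T := T) (J X) by move=> q; exact: theta_hlift.
have piJ X q : tmap (proj T) q (J X q) = I (proj T q) (tmap (proj T) q (X q)).
  exact: tmap_hlift.
have descI q u : tmap (sproj sh) q (hlift T (phi := proj T) (I (proj T q) u)) =
    IS (sproj sh q) (tmap (sproj sh) q (hlift T (phi := proj T) u)).
  by rewrite hI tmap_hlift.
have piSJ X q : horizontal_field (T := T) X ->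
    tmap (sproj sh) q (J X q) = IS (sproj sh q) (tmap (sproj sh) q (X q)).
  by move=> hX; rewrite descI (hlift_unique tM (hX q) erefl).
(* J X is determined by its images under theta and the differential of proj T,
   which are smooth. *)
have sJ X : smooth_sec X p -> horizontal_field (T := T) X -> smooth_sec (J X) p.
  move=> sX hX.
  apply: (smooth_sec_of_images (L1 := theta T) (L2 := tmap_hom (proj T))).
  - exact: (tM p).2.
  - have -> : (fun q => theta T q (J X q)) = (fun q => theta T q (X q)).
      by apply: functional_extensionality_dep => q; rewrite hJ hX.
    exact: happ_smooth.
  have -> : (fun q => tmap_hom (proj T) q (J X q)) =
            (fun q => I (proj T q) (tmap (proj T) q (X q))).
    by apply: functional_extensionality_dep => q; exact: piJ.
  exact: (pullback_hom_smooth I (tmap_smooth sX)).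
have [U [hU sU Up]] := horizontal_through (theta_hlift tM v).
have [V [hV sV Vp]] := horizontal_through (theta_hlift tM w).
have EM := nijenhuis_jet_along sU sV (sJ U sU hU) (sJ V sV hV) (piJ U) (piJ V).
have ES := nijenhuis_jet_along sU sV (sJ U sU hU) (sJ V sV hV)
  (fun q => piSJ U q hU) (fun q => piSJ V q hV).
have piU : tmap (proj T) p (U p) = v by rewrite Up tmap_hlift.
have piV : tmap (proj T) p (V p) = w by rewrite Vp tmap_hlift.
rewrite piU piV in EM; rewrite Up Vp in ES.
apply: esym; apply: (hlift_unique tS (theta_hlift tM _)).
apply: (etrans _ (esym (nijenhuisE _ _ _))); apply: (etrans _ ES).
have B X Y := @tmap_sproj_bracket _ _ _ _ _ _ _ _ _ _ _ _ sh p X Y.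
have B1 := B _ _ (sJ U sU hU) (sJ V sV hV) (hJ U) (hJ V).
have B2 := B _ _ (sJ U sU hU) sV (hJ U) hV.
have B3 := B _ _ sU (sJ V sV hV) hU (hJ V).
have B4 := B _ _ sU sV hU hV.
rewrite !piJ piU piV in B1 B2 B3 B4.
have IB X u : tmap (sproj sh) p X = descend sh u ->
    IS (sproj sh p) (tmap (sproj sh) p X) = descend sh (I (proj T p) u).
  by move=> ->; rewrite /descend descI.
have dB u u' : descend sh (u - u') = descend sh u - descend sh u'.
  by rewrite descendD descendN.
apply: (etrans _ (esym (congr2 (fun a b => a - b) (congr2 (fun a b => a - b)
  (congr2 (fun a b => a - b) B1 (IB _ _ B2)) (IB _ _ B3)) B4))).
rewrite -!dB; apply: (congr1 (fun u => descend sh u)).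
rewrite (etrans (nijenhuisE I v w) (esym EM)) /Phi.
exact: collect_curvature.
Qed.
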